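(* Assume $\mathrm{P}\ne\mathrm{NP}$. Then there is no polynomial-time approximation scheme (PTAS) for the following minimization problem, even on planar graphs: the input is an integer $q\ge1$, a planar graph $G=(V,E)$, vertex potentials $\psi_i$ on $[q]$ ($i\in V$), edge potentials $\psi_{ij}$ on $[q]\times[q]$ ($(i,j)\in E$) and constants $\alpha_{ij},\alpha_{ji}$ with $\alpha_{ij}+\alpha_{ji}=1$ for each edge $(i,j)\in E$, such that the derived functions $$f_i(\sigma)=\psi_i(\sigma_i)+\sum_{j\in N(i)}\alpha_{ij}\,\psi_{ij}(\sigma_i,\sigma_j)$$ satisfy $f_i\ge0$ for all $i\in V$; the goal is to find $\sigma\in[q]^V$ minimizing the energy $E(\sigma)=\sum_{i\in V}\psi_i(\sigma_i)+\sum_{(i,j)\in E}\psi_{ij}(\sigma_i,\sigma_j)=\sum_{i\in V}f_i(\sigma)$.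
   Context: $[q]$ is a set of $q$ values, $N(i)$ is the set of neighbours of $i$, and on an edge $(i,j)$ both $f_i$ and $f_j$ use the same function $\psi_{ij}$ (so $\psi_{ji}(\sigma_j,\sigma_i)=\psi_{ij}(\sigma_i,\sigma_j)$). The potentials are part of the input and may take the value $+\infty$. Each $f_i$ is assumed evaluable in $O(1)$ time. PTAS (minimization): an algorithm that, given an instance of size $n$ and $\epsilon>0$, runs in time $n^{O(F(1/\epsilon))}$ for some function $F$ (so polynomial for each fixed $\epsilon$) and returns a solution of value at most $(1+\epsilon)$ times the optimum. *)

(* Defs.v *)
From HB Require Import structures.
From mathcomp Require Import all_boot all_order all_algebra.
From mathcomp Require Import all_classical all_reals all_analysis.
Import Order.TTheory GRing.Theory Num.Theory.
Import numFieldNormedType.Exports.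

Set Implicit Arguments.
Unset Strict Implicit.
Unset Printing Implicit Defensive.

(******************************************************************************)
(* Complexity: deterministic multi-tape Turing machines on words over bool.   *)
(******************************************************************************)

Definition word := seq bool.

(* None is the blank, Some (inl b) an input/output bit, Some (inr a) an
   auxiliary symbol. *)
Definition symbol (aux : finType) : finType := option (bool + aux)%type.

Inductive move := MoveLeft | Stay | MoveRight.

(* The machine has extra_tapes.+1 tapes. *)
Record machine := Machine {
  extra_tapes : nat;
  state : finType;
  aux : finType;
  start : state;
  halting : pred state;
  trans : state -> {ffun 'I_extra_tapes.+1 -> symbol aux} ->
    state * ('I_extra_tapes.+1 -> symbol aux * move)
}.

(* A two-way infinite tape (l, r): the head scans the first symbol of r, and l
   lists the symbols to its left, nearest first; all other cells are blank. *)
Definition tape (A : finType) := (seq (symbol A) * seq (symbol A))%type.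

Definition scan (A : finType) (t : tape A) : symbol A := head None t.2.

Definition write_move (A : finType) (am : symbol A * move) (t : tape A) :
    tape A :=
  let: (a, m) := am in
  let: (l, r) := t in
  match m with
  | Stay => (l, a :: behead r)
  | MoveRight => (a :: l, behead r)
  | MoveLeft => (behead l, head None l :: a :: behead r)
  end.

Definition configuration (M : machine) :=
  (state M * {ffun 'I_(extra_tapes M).+1 -> tape (aux M)})%type.

Definition step (M : machine) (c : configuration M) : configuration M :=
  if halting c.1 then c
  else
    let: (s, act) := trans c.1 [ffun i => scan (c.2 i)] in
    (s, [ffun i => write_move (act i) (c.2 i)]).

(* The input is on tape 0, with the head on its first symbol. *)
Definition init (M : machine) (x : word) : configuration M :=
  (@start M,
   [ffun i => ([::], if i == ord0 then [seq Some (inl b) | b <- x] else [::])]).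

Fixpoint leading_bits (A : finType) (r : seq (symbol A)) : word :=
  if r is Some (inl b) :: r' then b :: leading_bits r' else [::].

(* The output is the longest word of bits on tape 0 starting at the head. *)
Definition output (M : machine) (c : configuration M) : word :=
  leading_bits (c.2 ord0).2.

Definition runs_in (M : machine) (x : word) (t : nat) (y : word) : Prop :=
  let c := iter t (@step M) (init M x) in halting c.1 /\ output c = y.

Definition language := word -> Prop.

Definition in_P (L : language) : Prop :=
  exists (M : machine) (c : nat), forall x : word,
    exists2 y : word, runs_in M x (size x ^ c + c)%N y & (L x <-> y = [:: true]).

(* Self-delimiting copy of a word. *)
Definition delimit (x : word) : word :=
  flatten [seq [:: true; b] | b <- x] ++ [:: false].

Definition pair_word (x w : word) : word := delimit x ++ w.

Definition in_NP (L : language) : Prop :=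
  exists (V : language) (c : nat), in_P V /\
    forall x : word,
      L x <-> exists2 w : word, (size w <= size x ^ c + c)%N & V (pair_word x w).

Definition P_neq_NP : Prop := ~ (forall L : language, in_P L <-> in_NP L).

(******************************************************************************)
(* Planar graphs                                                              *)
(******************************************************************************)

Section Planarity.
Local Open Scope ring_scope.
Local Open Scope classical_set_scope.

(* A drawing in the plane R x R: distinct points for the vertices, and for each
   edge {i, j} with i < j a simple arc from point i to point j whose interior
   meets neither a vertex nor the interior of the arc of another edge. *)
Definition planar (R : realType) (n : nat) (adj : rel 'I_n) : Prop :=
  exists (pt : 'I_n -> R * R) (arc : 'I_n -> 'I_n -> R -> R * R),
    let edge (i j : 'I_n) := (i < j)%N && adj i j in
    [/\ injective pt,
        forall i j, edge i j ->
          [/\ {within `[0, 1], continuous (arc i j)},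
              {in `[0, 1] &, injective (arc i j)},
              arc i j 0 = pt i
            & arc i j 1 = pt j],
        forall i j k (t : R), edge i j -> 0 < t < 1 -> arc i j t <> pt k
      & forall i j k l (s t : R), edge i j -> edge k l ->
          0 < s < 1 -> 0 < t < 1 -> arc i j s = arc k l t -> (i, j) = (k, l)].

End Planarity.

(******************************************************************************)
(* The energy minimization problem                                            *)
(******************************************************************************)

(* Vertices are 'I_nvert and labels 'I_nlab. Only the values of epot and alpha
   on adjacent pairs are meaningful. *)
Record instance := Instance {
  nlab : nat;
  nvert : nat;
  adj : rel 'I_nvert;
  vpot : 'I_nvert -> 'I_nlab -> \bar rat;
  epot : 'I_nvert -> 'I_nvert -> 'I_nlab -> 'I_nlab -> \bar rat;
  alpha : 'I_nvert -> 'I_nvert -> rat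
}.

Definition labelling (I : instance) := {ffun 'I_(nvert I) -> 'I_(nlab I)}.

Section Energy.
Local Open Scope ereal_scope.

(* In \bar rat, 0 * +oo = 0 and -oo + +oo = -oo. *)
Definition local_energy (I : instance) (i : 'I_(nvert I)) (s : labelling I) :
    \bar rat :=
  vpot i (s i) +
  \sum_(j < nvert I | adj i j) (alpha i j)%:E * epot i j (s i) (s j).

Definition energy (I : instance) (s : labelling I) : \bar rat :=
  \sum_(i < nvert I) vpot i (s i) +
  \sum_(i < nvert I) \sum_(j < nvert I | (i < j)%N && adj i j)
     epot i j (s i) (s j).

Definition optimum (I : instance) : \bar rat :=
  \big[mine/+oo]_(s : labelling I) energy s.

Definition valid_instance (R : realType) (I : instance) : Prop :=
  [/\ (1 <= nlab I)%N,
      [/\ symmetric (@adj I), irreflexive (@adj I) & planar R (@adj I)],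
      [/\ forall i a, @vpot I i a != -oo,
          forall i j a b, @adj I i j -> epot i j a b != -oo
        & forall i j a b, @adj I i j -> epot j i b a = epot i j a b],
      forall i j, @adj I i j -> (alpha i j + alpha j i = 1)%R
    & forall (i : 'I_(nvert I)) (s : labelling I), 0 <= local_energy i s].

Lemma energy_sum_local (R : realType) (I : instance) (s : labelling I) :
  valid_instance R I -> energy s = \sum_(i < nvert I) local_energy i s.
Proof.
move=> [_ [adjC adjI _] [_ epotN epotC] alpha1 f_ge0].
rewrite /energy /local_energy big_split /=; congr (_ + _).
pose T (i j : 'I_(nvert I)) := (alpha i j)%:E * epot i j (s i) (s j).
have TN i j : adj i j -> T i j != -oo.
  move=> aij; apply/eqP => TE; have := f_ge0 i s.
  by rewrite /local_energy (bigD1 j) //= -/(T i j) TE addNye addeNy.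
have split_edge i j : adj i j -> epot i j (s i) (s j) = T i j + T j i.
  move=> aij; have aji : adj j i by rewrite adjC.
  have := TN _ _ aij; have := TN _ _ aji; have := epotN _ _ (s i) (s j) aij.
  have := alpha1 _ _ aij; rewrite /T (epotC _ _ (s i) (s j) aij).
  case: (epot i j _ _) => [r| |] //= al1 _.
    by move=> _ _; rewrite -!EFinM -EFinD -mulrDl al1 mul1r.
  case: (ltgtP (alpha i j) 0%R) => [a0|a0|a0].
  - by move=> _; rewrite lt0_muley ?lte_fin.
  - case: (ltgtP (alpha j i) 0%R) => [b0|b0|b0].
    + by rewrite lt0_muley ?lte_fin.
    + by rewrite !gt0_muley ?lte_fin.
    + by rewrite b0 mul0e adde0 gt0_muley ?lte_fin.
  - move: al1; rewrite a0 add0r => ->.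
    by rewrite mul0e add0e mul1e.
transitivity (\sum_(i < nvert I) \sum_(j < nvert I | (i < j)%N && adj i j) T i j
   + \sum_(i < nvert I) \sum_(j < nvert I | (i < j)%N && adj i j) T j i).
  rewrite -big_split /=; apply: eq_bigr => i _.
  by rewrite -big_split /=; apply: eq_bigr => j /andP[_ /split_edge].
rewrite [X in _ + X](exchange_big_dep xpredT) //= -big_split /=.
apply: eq_bigr => i _.
rewrite [RHS](bigID (fun j : 'I_(nvert I) => (i < j)%N)) /=.
congr (_ + _); apply: eq_bigl => j; first by rewrite andbC.
rewrite (adjC j i) andbC -leqNgt; case: ltngtP => //= /val_inj ->.
by rewrite adjI.
Qed.

End Energy.

(******************************************************************************)
(* Binary encodings of inputs and outputs                                     *)
(******************************************************************************)

(* Binary digits, least significant first; k is the recursion fuel. *)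
Fixpoint bits_rec (k m : nat) : word :=
  if k is k'.+1 then if m == 0 then [::] else odd m :: bits_rec k' m./2
  else [::].
Definition bits (m : nat) : word := bits_rec m m.

Definition enc_nat (m : nat) : word := delimit (bits m).

(* Labels and the numbers of labels and vertices are written in unary; this
   preserves sizes up to a polynomial, since the potentials are tabulated. *)
Definition enc_unary (m : nat) : word := nseq m true ++ [:: false].

Definition enc_rat (r : rat) : word :=
  (r < 0)%R :: enc_nat `|numq r|%N ++ enc_nat `|denq r|%N.

Definition enc_ereal (v : \bar rat) : word :=
  match v with
  | r%:E => true :: enc_rat r
  | +oo => [:: false; false]
  | -oo => [:: false; true]
  end%E.

Definition enc_edge (I : instance) (i j : 'I_(nvert I)) : word :=
  if adj i j then
    true :: (\big[cat/[::]]_(a < nlab I) \big[cat/[::]]_(b < nlab I)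
               enc_ereal (epot i j a b))
         ++ enc_rat (alpha i j) ++ enc_rat (alpha j i)
  else [:: false].

Definition enc_instance (I : instance) : word :=
  enc_unary (nlab I) ++ enc_unary (nvert I)
  ++ (\big[cat/[::]]_(i < nvert I) \big[cat/[::]]_(a < nlab I)
        enc_ereal (vpot i a))
  ++ (\big[cat/[::]]_(i < nvert I) \big[cat/[::]]_(j < nvert I | (i < j)%N)
        enc_edge i j).

Definition enc_labelling (I : instance) (s : labelling I) : word :=
  \big[cat/[::]]_(i < nvert I) enc_unary (s i).

(******************************************************************************)
(* Approximation schemes                                                      *)
(******************************************************************************)

(* On eps and I, machine A returns a (1 + eps)-approximate labelling within
   time n ^ O(F (1 / eps)), where n is the encoding size of I (always n >= 2). *)
Definition is_PTAS (R : realType) (A : machine) : Prop :=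
  exists (F : rat -> nat) (c : nat),
    forall (I : instance) (eps : rat), valid_instance R I -> (0 < eps)%R ->
      exists2 s : labelling I,
        runs_in A (enc_rat eps ++ enc_instance I)
          (size (enc_instance I) ^ (c * F (eps^-1)%R))%N (enc_labelling s)
        & (energy s <= (1 + eps)%:E * optimum I)%E.

(* Main.v *)
(* A PTAS yields P = NP, for NP reduces to the following gap problem on grids.
   Given a verifier and an input x, the grid has one row per time step and one
   column per tape cell; a label of a vertex is the local content of all tapes at
   that time and cell, together with the state and the symbols scanned at that
   time. Horizontal edges make this global information constant along a row,
   and vertical edges impose one step of the machine, so that labellings of finite
   energy are the accepting computations on x and some witness w. No gadget
   for crossings is needed since tapes are tracks of a single grid. One more label
   allows giving up on the whole grid at cost 1: the optimum is then 0 if x is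
   accepted and 1 otherwise, and for eps = 1 the label that the PTAS returns on the
   first vertex decides which. The encoding of the instance is produced by nested
   loops, which compile to a polynomial-time machine. *)

Require Import Defs.
From mathcomp Require Import all_boot all_order all_algebra.
From mathcomp Require Import all_classical all_reals all_analysis.
From mathcomp Require Import zify lra.
Import Order.TTheory GRing.Theory Num.Theory.
Import numFieldNormedType.Exports.

Set Implicit Arguments.
Unset Strict Implicit.
Unset Printing Implicit Defensive.

(** Apart from the price of giving up, potentials are 0 or [+oo]; hence an accepted input has
    optimum 0, and a multiplicative guarantee forces energy 0. With eps fixed, the exponent in the
    running time of the PTAS is a constant.

    One obstacle is locality: edges compare neighbouring cells only, while the heads of a multi-tape
    machine stand in different columns. Each cell therefore records on which side of each head it
    lies, which turns having exactly one head into a condition on neighbours. Heads start too far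
    from both borders to reach them, and a halted configuration repeats itself, so the shape of the
    grid depends on the length of the input alone.

    The other obstacle is that P is defined by concrete machines. Instances are written by
    generators that can concatenate, copy and loop over words; every generator has a polynomial cost
    by construction. They cannot subtract or compare numbers, so the dimensions of the grid are
    chosen to make all lengths sums and products.

    Since the assumption denies an equality of classes, the inclusion of P in NP is proved as
    well. *)

(** * Polynomial bounds *)

Lemma leq_expl e m n : m <= n -> m ^ e <= n ^ e.
Proof. by move=> mn; elim: e => // e IHe; rewrite !expnS leq_mul. Qed.

(** The base [n + 2] is at least 2, so constants and sums are absorbed by a larger exponent. *)
Definition poly_bounded (f : nat -> nat) := exists c, forall n, f n <= (n + 2) ^ c.

Lemma poly_bounded_le f g :
  (forall n, f n <= g n) -> poly_bounded g -> poly_bounded f.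
Proof. by move=> fg [c gc]; exists c => n; exact: leq_trans (fg n) (gc n). Qed.

Lemma poly_bounded_const k : poly_bounded (fun=> k).
Proof.
exists k => n; apply: leq_trans (ltnW (ltn_expl k (ltnSn 1))) _.
by rewrite leq_expl // leq_addl.
Qed.

Lemma poly_bounded_id : poly_bounded id.
Proof. by exists 1 => n; rewrite expn1 leq_addr. Qed.

Lemma poly_boundedD f g :
  poly_bounded f -> poly_bounded g -> poly_bounded (fun n => f n + g n).
Proof.
move=> [a fa] [b gb]; exists (a + b).+1 => n.
have le_f : f n <= (n + 2) ^ (a + b).
  by apply: leq_trans (fa n) _; rewrite leq_pexp2l ?leq_addr // addn2.
have le_g : g n <= (n + 2) ^ (a + b).
  by apply: leq_trans (gb n) _; rewrite leq_pexp2l ?leq_addl // addn2.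
apply: leq_trans (leq_add le_f le_g) _.
by rewrite addnn -mul2n expnS leq_mul2r leq_addl orbT.
Qed.

Lemma poly_boundedS f : poly_bounded f -> poly_bounded (fun n => (f n).+1).
Proof.
move=> pf; apply: poly_bounded_le (poly_boundedD pf (poly_bounded_const 1)) => n.
by rewrite addn1.
Qed.

Lemma poly_boundedM f g :
  poly_bounded f -> poly_bounded g -> poly_bounded (fun n => f n * g n).
Proof.
by move=> [a fa] [b gb]; exists (a + b) => n; rewrite expnD leq_mul.
Qed.

Lemma poly_bounded_comp g f :
  poly_bounded g -> poly_bounded f -> poly_bounded (fun n => g (f n)).
Proof.
move=> [b gb] /poly_boundedD /(_ (poly_bounded_const 2)) [a fa].
exists (a * b) => n; apply: leq_trans (gb _) _.
by rewrite expnM leq_expl // fa.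
Qed.

Lemma poly_boundedX f k : poly_bounded f -> poly_bounded (fun n => f n ^ k).
Proof. by move=> [a fa]; exists (a * k) => n; rewrite expnM leq_expl. Qed.

Lemma poly_bounded_monomial f :
  poly_bounded f -> exists c, forall n, f n <= n ^ c + c.
Proof.
(* The summand [3 ^ a] covers [n <= 1]; for larger [n], [n + 2 <= n ^ 2] gives the exponent
   [a.*2]. *)
move=> [a fa]; exists (3 ^ a + a.*2) => n; apply: leq_trans (fa n) _.
have [n_le1|n_gt1] := leqP n 1.
  apply: leq_trans (leq_trans (leq_addr _ _) (leq_addl _ _)).
  by rewrite leq_expl //; lia.
apply: leq_trans (leq_addr _ _); apply: (@leq_trans (n ^ a.*2)).
  by rewrite -mul2n expnM leq_expl // ; nia.
by rewrite leq_pexp2l ?leq_addl // ltnW.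
Qed.

(** * Tapes up to blank cells *)

Section SameTape.
Variable A : finType.
Implicit Types t : tape A.

(** Steps leave explicit blanks at the ends of the two lists, so list equality would separate tapes
    with the same cells. *)
Definition same_tape t t' :=
  nth None t.1 =1 nth None t'.1 /\ nth None t.2 =1 nth None t'.2.

Lemma same_tape_trans t t' t'' :
  same_tape t t' -> same_tape t' t'' -> same_tape t t''.
Proof. by move=> [h1 h2] [k1 k2]; split=> i; rewrite (h1, h2) (k1, k2). Qed.

Lemma scanE t : scan t = nth None t.2 0.
Proof. by rewrite nth0. Qed.

Lemma same_scan t t' : same_tape t t' -> scan t = scan t'.
Proof. by move=> [_ h]; rewrite !scanE h. Qed.

Lemma same_write_move am t t' :
  same_tape t t' -> same_tape (write_move am t) (write_move am t').
Proof.
case: am t t' => a m [l r] [l' r'] [/= hl hr].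
by case: m; split=> -[|[|i]] //=;
  rewrite -?nth0 ?nth_behead ?hl ?hr.
Qed.

(** Every step acts on all tapes; an idle tape rewrites its scanned symbol in place. *)
Lemma same_write_scan t : same_tape (write_move (scan t, Stay) t) t.
Proof. by case: t => l [|a r]; split=> -[|[|i]]. Qed.

Lemma same_leading_bits t t' :
  same_tape t t' -> leading_bits t.2 = leading_bits t'.2.
Proof.
case: t t' => _ r [_ r'] [_ /=]; elim: r r' => [|a r IHr] [|a' r'] h //=.
- by have := h 0 => /= <-.
- by have := h 0 => /= ->.
- have /= -> := h 0; case: a' h => [[b|]|] // h.
  by rewrite (IHr r') // => i; exact: (h i.+1).
Qed.

End SameTape.

(** * Turing machine fragments *)

Section Fragments.
Variables (K : nat) (A : finType).

Definition tapes := {ffun 'I_K.+1 -> tape A}.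
Definition scans (ts : tapes) : {ffun 'I_K.+1 -> symbol A} :=
  [ffun i => scan (ts i)].
Definition write_moves (act : 'I_K.+1 -> symbol A * move) (ts : tapes) : tapes :=
  [ffun i => write_move (act i) (ts i)].

(* Leaving the fragment is encoded by the successor state None. *)
Record fragment := Fragment {
  fstate : finType;
  fstart : fstate;
  ftrans : fstate -> {ffun 'I_K.+1 -> symbol A} ->
    option fstate * ('I_K.+1 -> symbol A * move)
}.

Definition fstep f (c : option (fstate f) * tapes) : option (fstate f) * tapes :=
  if c.1 is Some s then
    let: (s', act) := ftrans s (scans c.2) in (s', write_moves act c.2)
  else c.

Lemma fstepE f s ts : @fstep f (Some s, ts) =
  ((ftrans s (scans ts)).1, write_moves (ftrans s (scans ts)).2 ts).
Proof. by rewrite /fstep /=; case: ftrans. Qed.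

Definition machine_of f : machine :=
  @Machine K (option (fstate f)) A (Some (fstart f)) (fun s => s == None)
    (fun s a => if s is Some s' then ftrans s' a else (None, fun i => (a i, Stay))).

Lemma step_machine_of f : @step (machine_of f) =1 @fstep f.
Proof. by move=> [[s|] ts]; rewrite /step /fstep. Qed.

Lemma iter_fstep_None f n ts : iter n (@fstep f) (None, ts) = (None, ts).
Proof. by elim: n => //= n ->. Qed.

Lemma iter_fstep_le f n m s ts ts' : n <= m ->
  iter n (@fstep f) (s, ts) = (None, ts') ->
  iter m (@fstep f) (s, ts) = (None, ts').
Proof. by move=> nm h; rewrite -(subnK nm) iterD h iter_fstep_None. Qed.

(** Total correctness with a time bound: [None] is absorbing, so being there after [n] steps means
    having left within [n] steps. *)
Variant hoare (P : tapes -> Prop) f n (Q : tapes -> Prop) : Prop :=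
  Hoare of forall ts, P ts -> exists2 ts',
    iter n (@fstep f) (Some (fstart f), ts) = (None, ts') & Q ts'.

Lemma hoare_weak (P P' : tapes -> Prop) f n m (Q Q' : tapes -> Prop) :
  (forall ts, P' ts -> P ts) -> n <= m -> (forall ts, Q ts -> Q' ts) ->
  hoare P f n Q -> hoare P' f m Q'.
Proof.
move=> PP nm QQ [h]; split=> ts /PP /h [ts' hts /QQ Qts].
by exists ts' => //; exact: iter_fstep_le nm hts.
Qed.

(* The exits of f become transitions to k inside g. *)
Lemma fstep_embed f g (e : fstate f -> fstate g) (k : option (fstate g)) :
  (forall s a, ftrans (e s) a =
     let: (s', act) := ftrans s a in
     (if s' is Some s'' then Some (e s'') else k, act)) ->
  forall n s ts ts', iter n (@fstep f) (Some s, ts) = (None, ts') ->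
  exists2 m, m <= n & iter m (@fstep g) (Some (e s), ts) = (k, ts').
Proof.
move=> he; elim=> [|n IHn] s ts ts' //; rewrite iterSr fstepE.
case E: (ftrans s (scans ts)) => [[s''|] act] /=.
  move=> /IHn [m mn hm]; exists m.+1; first by rewrite ltnS.
  by rewrite iterSr fstepE he E.
rewrite iter_fstep_None => -[<-]; exists 1 => //=.
by rewrite fstepE he E.
Qed.

Definition Seq f g : fragment :=
  @Fragment (fstate f + fstate g)%type (inl (fstart f))
    (fun s a => match s with
     | inl s1 => let: (s', act) := ftrans s1 a in
         (Some (if s' is Some s'' then inl s'' else inr (fstart g)), act)
     | inr s2 => let: (s', act) := ftrans s2 a in
         (if s' is Some s'' then Some (inr s'') else None, act)
     end).

Lemma hoare_Seq P Q R f g n m :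
  hoare P f n Q -> hoare Q g m R -> hoare P (Seq f g) (n + m) R.
Proof.
move=> [hf] [hg]; split=> ts /hf [ts1 h1 /hg [ts2 h2 R2]]; exists ts2 => //.
have [|i i_n hi] := @fstep_embed f (Seq f g) inl (Some (inr (fstart g))) _ _ _ _ _ h1.
  by move=> s a /=; case: ftrans => -[].
have [|j j_m hj] := @fstep_embed g (Seq f g) inr None _ _ _ _ _ h2.
  by move=> s a /=; case: ftrans => -[].
apply: (@iter_fstep_le _ (j + i)); first by rewrite addnC leq_add.
by rewrite iterD hi hj.
Qed.

(** * Tapes as stacks *)

Implicit Types (sigma : nat -> word) (i : nat) (b : bool) (w : word).

Definition cells w : seq (symbol A) := [seq Some (inl b) | b <- w].

(** Each tape is a stack with its top under the head and only blanks to the left; a scanned blank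
    means that the stack is empty. *)
Definition rep sigma (ts : tapes) :=
  forall i : 'I_K.+1, same_tape (ts i) ([::], cells (sigma i)).

Definition upd sigma i w : nat -> word := fun j => if j == i then w else sigma j.

Definition exec sigma f n sigma' := hoare (rep sigma) f n (rep sigma').

Lemma rep_ext sigma sigma' ts :
  (forall i, i <= K -> sigma i = sigma' i) -> rep sigma ts -> rep sigma' ts.
Proof. by move=> e h i; rewrite -e; [exact: h | rewrite -ltnS]. Qed.

Lemma exec_le sigma f n m sigma' :
  exec sigma f n sigma' -> n <= m -> exec sigma f m sigma'.
Proof. by move=> h nm; apply: hoare_weak h. Qed.

Lemma exec_ext sigma1 sigma2 f n sigma1' sigma2' :
  exec sigma1 f n sigma1' -> sigma1 =1 sigma2 -> sigma1' =1 sigma2' ->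
  exec sigma2 f n sigma2'.
Proof.
by move=> h e e'; apply: hoare_weak h => // ts; apply: rep_ext => // i _.
Qed.

Lemma exec_Seq sigma1 sigma2 sigma3 f g n m :
  exec sigma1 f n sigma2 -> exec sigma2 g m sigma3 ->
  exec sigma1 (Seq f g) (n + m) sigma3.
Proof. exact: hoare_Seq. Qed.

Definition keep_except i (a : {ffun 'I_K.+1 -> symbol A}) (am : symbol A * move) :
    'I_K.+1 -> symbol A * move :=
  fun j => if j == i :> nat then am else (a j, Stay).

Lemma rep_keep_except sigma i am w ts : rep sigma ts -> i <= K ->
  same_tape (write_move am ([::], cells (sigma i))) ([::], cells w) ->
  rep (upd sigma i w) (write_moves (keep_except i (scans ts) am) ts).
Proof.
move=> rts iK hw j; rewrite /upd ffunE /keep_except.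
have [ji|_] := eqVneq (j : nat) i; last first.
  by rewrite ffunE; apply: same_tape_trans (same_write_scan _) (rts j).
by apply: same_tape_trans hw; apply: same_write_move; rewrite -ji.
Qed.

Definition Skip : fragment :=
  @Fragment unit tt (fun _ a => (None, fun j => (a j, Stay))).

Lemma exec_Skip sigma : exec sigma Skip 1 sigma.
Proof.
split=> ts rts; eexists; first by rewrite /= !fstepE /=.
move=> i; rewrite !ffunE; exact: same_tape_trans (same_write_scan _) (rts i).
Qed.

(** A step writes before it moves, so a push takes two: go left onto a blank cell, then write
    there. *)
Definition Push i b : fragment :=
  @Fragment bool false (fun s a =>
    if s then (None, keep_except i a (Some (inl b), Stay))
    else (Some true, keep_except i a (a (inord i), MoveLeft))).

Lemma exec_Push sigma i b : i <= K ->
  exec sigma (Push i b) 2 (upd sigma i (b :: sigma i)).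
Proof.
move=> iK; split=> ts rts; eexists; first by rewrite /= !fstepE /=.
set ts1 := write_moves _ ts => j.
rewrite ffunE /keep_except /upd.
have [ji|ji] := eqVneq (j : nat) i; last first.
  rewrite ffunE; apply: same_tape_trans (same_write_scan _) _.
  rewrite ffunE /keep_except (negPf ji) ffunE.
  exact: same_tape_trans (same_write_scan _) (rts j).
have -> : ts1 j = write_move (scan (ts j), MoveLeft) (ts j).
  rewrite ffunE /keep_except ji eqxx ffunE.
  by have -> : inord i = j by apply: val_inj; rewrite /= inordK.
have [] := rts j; rewrite ji; case: (ts j) => l r /= hl hr.
split=> -[|[|k]] //=; rewrite ?nth_behead ?hl ?nth_nil //.
by rewrite scanE hr.
Qed.

(** The popped cell is blanked before the head passes it, because [rep] wants blanks on the left. *)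
Definition pop_dispatch i (T : Type) (kt kf kn : option T)
    (a : {ffun 'I_K.+1 -> symbol A}) : option T * ('I_K.+1 -> symbol A * move) :=
  if a (inord i) is Some (inl b) then
    (if b then kt else kf, keep_except i a (None, MoveRight))
  else (kn, fun j => (a j, Stay)).

Lemma pop_dispatch_cons sigma i b w T (kt kf kn : option T) ts : i <= K ->
  rep sigma ts -> sigma i = b :: w ->
  exists2 act, pop_dispatch i kt kf kn (scans ts) = (if b then kt else kf, act)
    & rep (upd sigma i w) (write_moves act ts).
Proof.
move=> iK rts si; have := rts (inord i); rewrite inordK // => /same_scan hi.
rewrite /pop_dispatch ffunE hi /scan /= si /=; eexists; first by [].
apply: rep_keep_except => //; rewrite si.
by split=> // -[|k]; rewrite /= ?nth_nil.
Qed.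

Lemma pop_dispatch_nil sigma i T (kt kf kn : option T) ts : i <= K ->
  rep sigma ts -> sigma i = [::] ->
  exists2 act, pop_dispatch i kt kf kn (scans ts) = (kn, act)
    & rep sigma (write_moves act ts).
Proof.
move=> iK rts si; have := rts (inord i); rewrite inordK // => /same_scan hi.
rewrite /pop_dispatch ffunE hi /scan /= si /=; eexists; first by [].
by move=> j; rewrite !ffunE; exact: same_tape_trans (same_write_scan _) (rts j).
Qed.

Definition Case i f1 f0 fn : fragment :=
  @Fragment (option (fstate f1 + (fstate f0 + fstate fn)))%type None
    (fun s a => match s with
     | None => pop_dispatch i (Some (Some (inl (fstart f1))))
         (Some (Some (inr (inl (fstart f0))))) (Some (Some (inr (inr (fstart fn))))) a
     | Some (inl s) => let: (s', act) := ftrans s a in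
         (if s' is Some s'' then Some (Some (inl s'')) else None, act)
     | Some (inr (inl s)) => let: (s', act) := ftrans s a in
         (if s' is Some s'' then Some (Some (inr (inl s''))) else None, act)
     | Some (inr (inr s)) => let: (s', act) := ftrans s a in
         (if s' is Some s'' then Some (Some (inr (inr s''))) else None, act)
     end).

Lemma exec_Case_cons sigma sigma' i b w f1 f0 fn n : i <= K ->
  sigma i = b :: w ->
  exec (upd sigma i w) (if b then f1 else f0) n sigma' ->
  exec sigma (Case i f1 f0 fn) n.+1 sigma'.
Proof.
move=> iK si [hb]; split=> ts rts.
have [act E /hb [ts' h' r']] := pop_dispatch_cons
  (Some (Some (inl (fstart f1)))) (Some (Some (inr (inl (fstart f0)))))
  (Some (Some (inr (inr (fstart fn))))) iK rts si.
exists ts' => //; rewrite iterSr fstepE /= E /=.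
case: b {hb si E} h' => h'.
- have [|m mn hm] := @fstep_embed f1 (Case i f1 f0 fn) (Some \o inl) None _ _ _ _ _ h'.
    by move=> s a /=; case: ftrans => -[].
  exact: iter_fstep_le mn hm.
- have [|m mn hm] := @fstep_embed f0 (Case i f1 f0 fn) (Some \o inr \o inl) None _ _ _ _ _ h'.
    by move=> s a /=; case: ftrans => -[].
  exact: iter_fstep_le mn hm.
Qed.

Lemma exec_Case_nil sigma sigma' i f1 f0 fn n : i <= K ->
  sigma i = [::] -> exec sigma fn n sigma' ->
  exec sigma (Case i f1 f0 fn) n.+1 sigma'.
Proof.
move=> iK si [hb]; split=> ts rts.
have [act E /hb [ts' h' r']] := pop_dispatch_nil
  (Some (Some (inl (fstart f1)))) (Some (Some (inr (inl (fstart f0)))))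
  (Some (Some (inr (inr (fstart fn))))) iK rts si.
exists ts' => //; rewrite iterSr fstepE /= E /=.
have [|m mn hm] := @fstep_embed fn (Case i f1 f0 fn) (Some \o inr \o inr) None _ _ _ _ _ h'.
  by move=> s a /=; case: ftrans => -[].
exact: iter_fstep_le mn hm.
Qed.

Definition While i f1 f0 : fragment :=
  @Fragment (option (fstate f1 + fstate f0))%type None
    (fun s a => match s with
     | None => pop_dispatch i (Some (Some (inl (fstart f1))))
         (Some (Some (inr (fstart f0)))) None a
     | Some (inl s) => let: (s', act) := ftrans s a in
         (Some (if s' is Some s'' then Some (inl s'') else None), act)
     | Some (inr s) => let: (s', act) := ftrans s a in
         (Some (if s' is Some s'' then Some (inr s'') else None), act)
     end).

Lemma exec_While_nil sigma i f1 f0 : i <= K -> sigma i = [::] ->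
  exec sigma (While i f1 f0) 1 sigma.
Proof.
move=> iK si; split=> ts rts.
have [act E r'] := pop_dispatch_nil (Some (Some (inl (fstart f1))))
  (Some (Some (inr (fstart f0)))) None iK rts si.
by exists (write_moves act ts) => //=; rewrite fstepE /= E.
Qed.

(** The body may itself change stack [i], since the rest of the run starts from whatever [sigma1] it
    leaves; [Decode] relies on this. *)
Lemma exec_While_cons sigma sigma1 sigma2 i b w f1 f0 n m : i <= K ->
  sigma i = b :: w ->
  exec (upd sigma i w) (if b then f1 else f0) n sigma1 ->
  exec sigma1 (While i f1 f0) m sigma2 ->
  exec sigma (While i f1 f0) (n + m).+1 sigma2.
Proof.
move=> iK si [hb] [hw]; split=> ts rts.
have [act E /hb [ts1 h1 /hw [ts2 h2 r2]]] := pop_dispatch_cons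
  (Some (Some (inl (fstart f1)))) (Some (Some (inr (fstart f0)))) None iK rts si.
exists ts2 => //; rewrite iterSr fstepE /= E /=.
suff [j jn hj] : exists2 j, j <= n &
  iter j (@fstep (While i f1 f0))
    (if b then Some (Some (inl (fstart f1))) else Some (Some (inr (fstart f0))),
     write_moves act ts) = (Some None, ts1).
  apply: (@iter_fstep_le (While i f1 f0) (m + j)).
    by rewrite addnC leq_add2r.
  by rewrite iterD hj h2.
case: b {hb si E} h1 => h1.
- have [|j jn hj] := @fstep_embed f1 (While i f1 f0) (Some \o inl) (Some None) _ _ _ _ _ h1.
    by move=> s a /=; case: ftrans => -[].
  by exists j.
- have [|j jn hj] := @fstep_embed f0 (While i f1 f0) (Some \o inr) (Some None) _ _ _ _ _ h1.
    by move=> s a /=; case: ftrans => -[].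
  by exists j.
Qed.

End Fragments.

Arguments Skip {K A}.
Arguments Push {K A}.
Arguments exec_Skip {K A}.
Arguments exec_Push {K A} sigma {i} b.

(** * Running a machine inside a fragment with more tapes *)

Section Embedding.
Variables (M : machine) (K : nat).
Hypothesis leK : extra_tapes M <= K.

Definition Embed : fragment K (aux M) :=
  @Fragment K (aux M) (state M) (@start M) (fun s a =>
    if halting s then (None, fun j => (a j, Stay))
    else let: (s', act) := trans s [ffun i : 'I_(extra_tapes M).+1 => a (inord i)] in
      (Some s', fun j : 'I_K.+1 => if j <= extra_tapes M then act (inord j) else (a j, Stay))).

Definition embeds (ts : tapes K (aux M)) (c : configuration M) :=
  forall i : 'I_(extra_tapes M).+1, same_tape (ts (inord i)) (c.2 i).

Lemma iter_halting (c : configuration M) n :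
  halting c.1 -> iter n (@step M) c = c.
Proof. by move=> hc; elim: n => //= n ->; rewrite /step hc. Qed.

Lemma val_inord (i : 'I_(extra_tapes M).+1) : (inord i : 'I_K.+1) = i :> nat.
Proof. by rewrite inordK // ltnS (leq_trans _ leK) // -ltnS. Qed.

(** One step more than [M] takes: halting is a property of a state, whereas leaving a fragment is a
    transition. *)
Lemma Embed_iter t c ts : embeds ts c -> halting (iter t (@step M) c).1 ->
  exists2 ts', iter t.+1 (@fstep _ _ Embed) (Some c.1, ts) = (None, ts')
    & embeds ts' (iter t (@step M) c).
Proof.
have exit c' ts1 n : embeds ts1 c' -> halting c'.1 ->
    exists2 ts', iter n.+1 (@fstep _ _ Embed) (Some c'.1, ts1) = (None, ts')
      & embeds ts' c'.
  move=> hc hh; rewrite iterSr fstepE /= hh /=.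
  eexists; first exact: (@iter_fstep_None _ _ Embed).
  by move=> i; rewrite !ffunE; exact: same_tape_trans (same_write_scan _) (hc i).
elim: t c ts => [|t IHt] c ts hc; first exact: exit.
have [hh _|/negPf hh] := boolP (halting c.1).
  by rewrite iter_halting //; exact: exit.
rewrite iterSr => ht; rewrite iterSr fstepE /= hh /=.
have -> : [ffun i : 'I_(extra_tapes M).+1 => scans ts (inord i)] =
    [ffun i => scan (c.2 i)].
  by apply/ffunP => i; rewrite !ffunE (same_scan (hc i)).
have E : step c = ((trans c.1 [ffun i => scan (c.2 i)]).1,
   [ffun i => write_move ((trans c.1 [ffun i => scan (c.2 i)]).2 i) (c.2 i)]).
  by rewrite /step hh; case: trans.
rewrite E in ht *; case: trans ht => s' act /= ht.
apply: IHt ht => i; rewrite !ffunE val_inord -ltnS ltn_ord inord_val.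
exact: same_write_move.
Qed.

Lemma hoare_Embed x t y : runs_in M x t y ->
  hoare (fun ts => embeds ts (init M x)) Embed t.+1
        (fun ts => leading_bits (ts ord0).2 = y).
Proof.
move=> [hh <-]; split=> ts /Embed_iter /(_ hh) [ts' E' h']; exists ts' => //.
rewrite /output -(same_leading_bits (h' ord0)).
by congr (leading_bits (ts' _).2); apply: ord_inj; rewrite val_inord.
Qed.

(** Only the tapes of [M] have to be clean; higher tapes may keep what earlier fragments left
    there. *)
Lemma embeds_init sigma x ts : rep sigma ts -> sigma 0 = x ->
  (forall i, 0 < i <= extra_tapes M -> sigma i = [::]) ->
  embeds ts (init M x).
Proof.
move=> rts s0 sN i; rewrite ffunE.
have := rts (inord i); rewrite val_inord.
have [->|i0] := eqVneq i ord0; first by rewrite s0.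
by rewrite sN // lt0n i0 -ltnS ltn_ord.
Qed.

End Embedding.

(** * Word generators *)

(* Copy v outputs the v-th variable. For b g1 g0 runs through the reverse of the
   word produced by b; at nesting level l the word that remains to be read is
   the value of the variable l. *)
Inductive gen :=
| Emit of word
| Cat of gen & gen
| Copy of nat
| For of gen & gen & gen.

Fixpoint loop (F : word -> bool -> word) (s : word) : word :=
  if s is b :: s' then F s' b ++ loop F s' else [::].

(** Output is pushed on a stack, so a loop pops the word it runs through from its last bit on; hence
    the [rev]. *)
Fixpoint sem (l : nat) (env : nat -> word) (g : gen) : word :=
  match g with
  | Emit w => w
  | Cat g g' => sem l env g ++ sem l env g'
  | Copy v => env v
  | For g g1 g0 =>
      loop (fun s b => if b then sem l.+1 (upd env l s) g1
                       else sem l.+1 (upd env l s) g0)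
        (rev (sem l.+1 env g))
  end.

(** While the word of a loop is being produced, the tape of level [l] holds partial output: the
    level is taken, but the variable [l] is not yet readable. *)
Fixpoint scoped (vs : seq nat) (l : nat) (g : gen) : bool :=
  match g with
  | Emit w => true
  | Cat g g' => scoped vs l g && scoped vs l g'
  | Copy v => v \in vs
  | For g g1 g0 =>
      [&& scoped vs l.+1 g, scoped (l :: vs) l.+1 g1 & scoped (l :: vs) l.+1 g0]
  end.

(** [Copy] binds no variable but uses the tape of level [l] as scratch space. *)
Fixpoint depth (l : nat) (g : gen) : nat :=
  match g with
  | Emit w => l
  | Cat g g' => maxn (depth l g) (depth l g')
  | Copy v => l.+1
  | For g g1 g0 =>
      maxn l.+1 (maxn (depth l.+1 g) (maxn (depth l.+1 g1) (depth l.+1 g0)))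
  end.

(** One function bounds both running time and output length, for variables of length at most [n].
    Inside a loop the new variable is part of the loop word, hence the argument [n + cost g n]. *)
Fixpoint cost (g : gen) (n : nat) : nat :=
  match g with
  | Emit w => (size w).*2.+1
  | Cat g g' => cost g n + cost g' n
  | Copy v => n * 8 + 2
  | For g g1 g0 => cost g n +
      (cost g n * (cost g1 (n + cost g n) + cost g0 (n + cost g n) + 1) + 1)
  end.

Lemma poly_bounded_cost g : poly_bounded (cost g).
Proof.
elim: g => [w|g IH g' IH'|v|g IH g1 IH1 g0 IH0] /=.
- exact: poly_bounded_const.
- exact: poly_boundedD.
- apply: poly_boundedD (poly_bounded_const _).
  exact: poly_boundedM poly_bounded_id (poly_bounded_const _).
- apply: poly_boundedD => //; apply: poly_boundedD (poly_bounded_const _).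
  apply: poly_boundedM => //; apply: poly_boundedD (poly_bounded_const _).
  have IHn := poly_boundedD poly_bounded_id IH.
  by apply: poly_boundedD; [exact: (poly_bounded_comp IH1 IHn)
    | exact: (poly_bounded_comp IH0 IHn)].
Qed.

Lemma size_loop F s k : (forall s' b, size s' < size s -> size (F s' b) <= k) ->
  size (loop F s) <= size s * k.
Proof.
elim: s => //= b s IHs h; rewrite size_cat mulSn leq_add ?h //.
by apply: IHs => s' b' s's; rewrite h // (ltn_trans s's).
Qed.

(** * Compiling generators to machine fragments *)

Section Compile.
Variables (K base : nat) (A : finType).
Let frag := fragment K A.

Definition pushes i (w : word) : frag :=
  foldr (fun b f => Seq (Push i b) f) Skip w.

(** Reading a stack destroys it: the bits go to the output [j'] and to the scratch stack [j], from
    which [move_loop] restores the source. *)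
Definition copy_loop i j j' : frag :=
  While i (Seq (Push j true) (Push j' true))
          (Seq (Push j false) (Push j' false)).

Definition move_loop i j : frag := While i (Push j true) (Push j false).

Fixpoint compile (l out : nat) (g : gen) : frag :=
  match g with
  | Emit w => pushes out w
  | Cat g g' => Seq (compile l out g) (compile l out g')
  | Copy v => Seq (copy_loop (base + v) (base + l) out)
                  (move_loop (base + l) (base + v))
  | For g g1 g0 => Seq (compile l.+1 (base + l) g)
      (While (base + l) (compile l.+1 out g1) (compile l.+1 out g0))
  end.

Lemma exec_pushes sigma i w : i <= K ->
  exec sigma (pushes i w) (size w).*2.+1 (upd sigma i (rev w ++ sigma i)).
Proof.
move=> iK; elim: w sigma => [|b w IHw] sigma /=.
  apply: (exec_ext (exec_Skip sigma)) => // j; rewrite /upd.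
  by case: eqP => // ->.
rewrite doubleS -add2n; apply: (exec_Seq (exec_Push _ _ iK)).
apply: (exec_ext (IHw _)) => // j; rewrite /upd eqxx.
by case: eqP => // _; rewrite rev_cons cat_rcons.
Qed.

Lemma exec_move_loop sigma i j : i <= K -> j <= K -> i != j ->
  exec sigma (move_loop i j) (size (sigma i) * 3).+1
    (upd (upd sigma i [::]) j (rev (sigma i) ++ sigma j)).
Proof.
move=> iK jK ij; move: {2}(sigma i) (erefl (sigma i)) => w.
elim: w sigma => [|b w IHw] sigma si; rewrite si /=.
  apply: (exec_ext (exec_While_nil _ _ iK si)) => // k; rewrite /upd.
  by case: eqP => [->//|_]; case: eqP => [->|].
rewrite mulSn (_ : (3 + _).+1 = (2 + (size w * 3).+1).+1) //.
set s1 := upd sigma i w.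
have E : upd s1 j (b :: s1 j) i = w by rewrite /s1 /upd (negPf ij) eqxx.
have := IHw _ E; rewrite E; set s2 := upd s1 j _ => h2.
apply: (exec_While_cons (w := w) (b := b) (sigma1 := s2) iK si).
  by rewrite /s2; case: (b); exact: exec_Push.
apply: (exec_ext h2) => // k; rewrite /s2 /s1 /upd.
have [_|kj] := eqVneq k j; last by case: eqP.
by rewrite eqxx [j == i]eq_sym (negPf ij) rev_cons cat_rcons.
Qed.

Lemma exec_copy_loop sigma i j j' : i <= K -> j <= K -> j' <= K ->
  i != j -> i != j' -> j != j' ->
  exec sigma (copy_loop i j j') (size (sigma i) * 5).+1
    (upd (upd (upd sigma i [::]) j (rev (sigma i) ++ sigma j))
       j' (rev (sigma i) ++ sigma j')).
Proof.
move=> iK jK j'K ij ij' jj'; move: {2}(sigma i) (erefl (sigma i)) => w.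
elim: w sigma => [|b w IHw] sigma si; rewrite si /=.
  apply: (exec_ext (exec_While_nil _ _ iK si)) => // k; rewrite /upd.
  by case: eqP => [->//|_]; case: eqP => [->//|_]; case: eqP => [->|].
rewrite mulSn (_ : (5 + _).+1 = (2 + 2 + (size w * 5).+1).+1) //.
set s1 := upd sigma i w; set s2 := upd s1 j (b :: s1 j).
have E : upd s2 j' (b :: s2 j') i = w.
  by rewrite /s2 /s1 /upd (negPf ij) (negPf ij') eqxx.
have := IHw _ E; rewrite E; set s3 := upd s2 j' _ => h3.
apply: (exec_While_cons (w := w) (b := b) (sigma1 := s3) iK si).
  rewrite /s3 /s2; by case: (b); apply: (exec_Seq (exec_Push _ _ jK)); exact: exec_Push.
apply: (exec_ext h3) => // k; rewrite /s3 /s2 /s1 /upd.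
have [kj'|kj'] := eqVneq k j'.
  by rewrite eqxx [j' == j]eq_sym [j' == i]eq_sym (negPf jj') (negPf ij') rev_cons cat_rcons.
have [kj|kj] := eqVneq k j; last by case: eqP.
by rewrite eqxx [j == i]eq_sym (negPf jj') (negPf ij) rev_cons cat_rcons.
Qed.

(** Both claims are proved together because the length of a loop word bounds the number of
    iterations and the variables of the body. Tapes of level [l] and above are empty before and
    after, so they are free work space. The output may be the loop tape of the enclosing level,
    hence only [out < base + l]. *)
Lemma exec_compile g vs l out env sigma n :
    scoped vs l g -> base + depth l g <= K.+1 -> out <= K -> out < base + l ->
    (forall v, v \in vs -> [/\ v < l, base + v != out,
       sigma (base + v) = env v & size (env v) <= n]) ->
    (forall j, l <= j -> sigma (base + j) = [::]) ->
  size (sem l env g) <= cost g n /\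
  exec sigma (compile l out g) (cost g n)
    (upd sigma out (rev (sem l env g) ++ sigma out)).
Proof.
elim: g vs l out env sigma n
    => [w|g IH g' IH'|v|g IH g1 IH1 g0 IH0] vs l out env sigma n /=.
- by move=> _ _ outK _ _ _; split; [lia | exact: exec_pushes].
- move=> /andP[sg sg']; rewrite addn_maxr geq_max => /andP[dg dg'] outK outl hvs hl.
  have [sz ex] := IH _ _ _ _ _ _ sg dg outK outl hvs hl.
  have [||sz' ex'] := IH' _ _ _ env (upd sigma out (rev (sem l env g) ++ sigma out))
    n sg' dg' outK outl.
  + by move=> v /hvs[vl vout sv szv]; split=> //; rewrite /upd (negPf vout).
  + move=> j lj; rewrite /upd hl //; case: eqP => // jo.
    by move: outl; rewrite -jo ltn_add2l ltnNge lj.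
  split; first by rewrite size_cat leq_add.
  apply: (exec_Seq ex); apply: (exec_ext ex') => // j.
  by rewrite /upd eqxx; case: eqP => // _; rewrite rev_cat catA.
- move=> vvs dl outK outl /(_ v vvs)[vl vout sv szv] hl; split; first by lia.
  have lK : base + l <= K by rewrite -ltnS -addnS.
  have vK : base + v <= K by lia.
  have nvl : base + v != base + l by lia.
  have nlo : base + l != out by lia.
  have h1 := exec_copy_loop sigma vK lK outK nvl vout nlo.
  have := exec_move_loop (upd (upd (upd sigma (base + v) [::]) (base + l)
     (rev (env v) ++ sigma (base + l))) out (rev (env v) ++ sigma out)) lK vK.
  rewrite sv in h1 *; set s1 := upd _ out _ in h1 * => h2.
  have E : s1 (base + l) = rev (env v).
    by rewrite /s1 /upd (negPf nlo) eqxx hl // cats0.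
  move: h2; rewrite E size_rev => h2; rewrite eq_sym in nvl.
  have h := exec_Seq h1 (h2 nvl).
  apply: (@exec_le _ _ _ _ ((size (env v) * 5).+1 + (size (env v) * 3).+1)); last first.
    by rewrite addSn addnS -mulnDr addn2 !ltnS leq_mul2r szv orbT.
  apply: (exec_ext h) => // k; rewrite /s1 /upd revK.
  have [->|kv] := eqVneq k (base + v).
    by rewrite (negPf vout) [base + v == base + l]eq_sym (negPf nvl) eqxx cats0.
  have [->|kl] := eqVneq k (base + l); first by rewrite (negPf nlo) hl.
  by [].
- move=> /and3P[sg sg1 sg0]; rewrite !addn_maxr !geq_max.
  move=> /and4P[lK dg d1 d0] outK outl hvs hl.
  rewrite addnS ltnS in lK.
  have outl1 : out < base + l.+1 by lia.
  have [|||sz ex] := IH _ _ (base + l) env sigma n sg dg lK.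
  + by rewrite addnS.
  + by move=> v /hvs[vl vout sv szv]; split => //; lia.
  + by move=> j lj; rewrite hl // ltnW.
  set w := sem l.+1 env g in sz ex *; set F := fun s b => _.
  set m := n + cost g n.
  (* [st] ranges over the stores met during the loop: only the loop stack and [out] may differ from
     [sigma]. *)
  have body s b st : size s <= cost g n ->
      (forall j, j != base + l -> j != out -> st j = sigma j) -> st (base + l) = s ->
    size (F s b) <= cost g1 m + cost g0 m /\
    exec st (if b then compile l.+1 out g1 else compile l.+1 out g0)
      (cost g1 m + cost g0 m) (upd st out (rev (F s b) ++ st out)).
    move=> szs hst stl.
    have hvs' v : v \in l :: vs -> [/\ v < l.+1, base + v != out,
        st (base + v) = upd env l s v & size (upd env l s v) <= m].
      rewrite inE /upd; have [->|vl] := eqVneq v l.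
        by move=> _; split=> //; rewrite ?eqxx //; lia.
      move=> /= /hvs[vl' vout sv szv]; split => //; first lia.
        by rewrite hst //; lia.
      by lia.
    have hl' j : l.+1 <= j -> st (base + j) = [::].
      by move=> lj; rewrite hst ?hl //; lia.
    case: b.
      have [sz1 ex1] := IH1 _ _ out _ _ _ sg1 d1 outK outl1 hvs' hl'.
      by split; [apply: leq_trans sz1 _; lia | apply: (exec_le ex1); lia].
    have [sz0 ex0] := IH0 _ _ out _ _ _ sg0 d0 outK outl1 hvs' hl'.
    by split; [apply: leq_trans sz0 _; lia | apply: (exec_le ex0); lia].
  have nlo : base + l != out by lia.
  have szw : size (rev w) <= cost g n by rewrite size_rev.
  split.
    apply: leq_trans (size_loop (k := cost g1 m + cost g0 m) _) _.
      move=> s b ss; have [] := body s b (upd sigma (base + l) s).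
      * exact: leq_trans (ltnW ss) szw.
      * by move=> j jl _; rewrite /upd (negPf jl).
      * by rewrite /upd eqxx.
      * by [].
    apply: leq_trans (leq_mul szw (leqnn _)) _; lia.
  apply: (exec_Seq ex); rewrite hl // cats0.
  have wh s : size s <= cost g n -> forall st,
      (forall j, j != base + l -> j != out -> st j = sigma j) -> st (base + l) = s ->
    exec st (While (base + l) (compile l.+1 out g1) (compile l.+1 out g0))
      (size s * (cost g1 m + cost g0 m + 1) + 1)
      (upd (upd st (base + l) [::]) out (rev (loop F s) ++ st out)).
    elim: s => [|b s IHs] szs st hst stl /=.
      apply: (exec_ext (exec_While_nil _ _ lK stl)) => // j; rewrite /upd.
      by case: eqP => [->//|_]; case: eqP => [->|].
    set st1 := upd st (base + l) s.
    have h1 j : j != base + l -> j != out -> st1 j = sigma j.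
      by move=> jl jo; rewrite /st1 /upd (negPf jl) hst.
    have E1 : st1 (base + l) = s by rewrite /st1 /upd eqxx.
    have [_ ex1] := body s b st1 (ltnW szs) h1 E1.
    set st2 := upd st1 out _ in ex1.
    have h2 j : j != base + l -> j != out -> st2 j = sigma j.
      by move=> jl jo; rewrite /st2 /upd (negPf jo) h1.
    have E2 : st2 (base + l) = s by rewrite /st2 /upd (negPf nlo).
    have ex2 := IHs (ltnW szs) st2 h2 E2.
    rewrite (_ : _.+1 * _ + 1 = ((cost g1 m + cost g0 m) +
      (size s * (cost g1 m + cost g0 m + 1) + 1)).+1); last by lia.
    apply: (exec_ext (exec_While_cons lK stl ex1 ex2)) => // j.
    rewrite /st2 /st1 /upd eqxx [out == _]eq_sym (negPf nlo).
    by case: eqP => // _; [rewrite rev_cat catA | case: eqP].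
  have h1 j : j != base + l -> j != out -> upd sigma (base + l) (rev w) j = sigma j.
    by move=> jl _; rewrite /upd (negPf jl).
  have E1 : upd sigma (base + l) (rev w) (base + l) = rev w by rewrite /upd eqxx.
  have e := wh _ szw _ h1 E1.
  apply: (exec_le (exec_ext e _ _)) => //; last first.
    by rewrite leq_add2r leq_mul2r szw orbT.
  move=> j; rewrite /upd [out == _]eq_sym (negPf nlo).
  by case: eqP => // _; case: eqP => // ->; rewrite hl.
Qed.

End Compile.

(** * Polynomial-time machines *)

Definition input (x : word) : nat -> word := upd (fun=> [::]) 0 x.

Lemma in_P_of_fragment K A (f : fragment K A) t (L : language) :
  poly_bounded t ->
  (forall x, hoare (rep (input x)) f (t (size x))
     (fun ts => leading_bits (ts ord0).2 = [:: true] <-> L x)) ->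
  in_P L.
Proof.
move=> /poly_bounded_monomial[c tc] h; exists (machine_of f), c => x.
have [{}h] := h x.
have [|ts' E Lx] := h (init (machine_of f) x).2.
  move=> i; rewrite ffunE /input /upd.
  by have [->|i0] := eqVneq i ord0; [| rewrite ifN].
exists (leading_bits (ts' ord0).2); last by rewrite Lx.
rewrite /runs_in (eq_iter (@step_machine_of _ _ f)).
by rewrite (iter_fstep_le (tc _) E).
Qed.

Section Check.
Variables (K : nat) (A : finType).

(** Acceptance requires the output to be exactly [[:: true]], while only the first bit is
    informative: if it is [true], the next cell is blanked to cut off the rest. *)
Definition Check : fragment K A :=
  @Fragment K A bool false (fun s a =>
    if s then (None, keep_except 0 a (None, MoveLeft))
    else if a ord0 is Some (inl true) then
      (Some true, keep_except 0 a (Some (inl true), MoveRight))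
    else (None, fun j => (a j, Stay))).

Lemma hoare_Check y :
  hoare (fun ts : tapes K A => leading_bits (ts ord0).2 = y) Check 2
        (fun ts => leading_bits (ts ord0).2 = [:: true] <-> head false y = true).
Proof.
split=> ts <-; rewrite iterSr fstepE /=.
have -> : scans ts ord0 = scan (ts ord0) by rewrite ffunE.
case E: (ts ord0) => [l [|[[[]|a]|] r]] /=;
  by eexists; [exact: (@iter_fstep_None _ _ Check 1) | rewrite !ffunE E].
Qed.

End Check.

Lemma in_P_reduction (M : machine) (g : gen) (t : nat -> nat) (L : language) :
  scoped [:: 0] 1 g -> poly_bounded t ->
  (forall x, exists2 y, runs_in M (sem 1 (fun=> x) g) (t (size x)) y
     & (L x <-> head false y = true)) ->
  in_P L.
Proof.
(* Tapes up to [m] are reserved for [M]. Every transfer reverses a word: the input passes through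
   [Z] to reach [base] in its original order, and the generated word, reversed on [Z], is put right
   by the move to tape 0. *)
move=> sg pt hM; set m := extra_tapes M; pose Z := m.+1; pose base := m.+2.
pose K := base + depth 1 g.
have leK : m <= K by rewrite /K /base; lia.
have [K0 KZ Kb] : [/\ 0 <= K, Z <= K & base <= K].
  by rewrite /K /base /Z; split; lia.
pose f := Seq (move_loop K (aux M) 0 Z) (Seq (move_loop _ _ Z base)
  (Seq (compile K base _ 1 Z g) (Seq (move_loop _ _ Z 0)
  (Seq (Embed M K) (Check _ _))))).
pose T n := (n * 3).+1 + ((n * 3).+1 + (cost g n + ((cost g n * 3).+1 +
  ((t n).+1 + 2)))).
apply: (@in_P_of_fragment _ _ f T).
  have pc := poly_bounded_cost g.
  have p3 f' : poly_bounded f' -> poly_bounded (fun n => (f' n * 3).+1).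
    by move=> pf; exact: poly_boundedS (poly_boundedM pf (poly_bounded_const 3)).
  have pi := p3 _ poly_bounded_id.
  exact: poly_boundedD pi (poly_boundedD pi (poly_boundedD pc (poly_boundedD
    (p3 _ pc) (poly_boundedD (poly_boundedS pt) (poly_bounded_const 2))))).
move=> x; have [y run Ly] := hM x.
pose s1 := upd (fun=> [::]) Z (rev x).
pose s2 := upd (fun=> [::]) base x.
have h1 : exec (input x) (move_loop K (aux M) 0 Z) (size x * 3).+1 s1.
  have := @exec_move_loop K (aux M) (input x) _ _ K0 KZ isT.
  rewrite /input {1 2 3}/upd /=; move/exec_ext; apply=> // j.
  by rewrite /upd /s1 /upd /= cats0; case: eqP => // _; case: eqP.
have h2 : exec s1 (move_loop K (aux M) Z base) (size x * 3).+1 s2.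
  have Zb : Z != base by rewrite /Z /base; lia.
  have := @exec_move_loop K (aux M) s1 _ _ KZ Kb Zb.
  have -> : s1 Z = rev x by rewrite /s1 /upd eqxx.
  have -> : s1 base = [::] by rewrite /s1 /upd eq_sym (negPf Zb).
  rewrite size_rev revK cats0; move/exec_ext; apply=> // j.
  by rewrite /s1 /s2 /upd; case: eqP => // _; case: eqP.
set w := sem 1 (fun=> x) g in run.
have [] := @exec_compile K base (aux M) g [:: 0] 1 Z (fun=> x) s2 (size x) sg.
- by rewrite leqW.
- by [].
- by rewrite addn1 /Z /base; lia.
- move=> v; rewrite inE => /eqP ->; split=> //; rewrite ?addn0 ?/s2 ?/upd ?eqxx //.
  by rewrite /base /Z; lia.
- by move=> j j0; rewrite /s2 /upd ifN //; lia.
rewrite -/w => szw; set s3 := upd s2 Z _ => h3.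
have s3Z : s3 Z = rev w.
  by rewrite /s3 /upd eqxx /s2 /upd ifN ?cats0 // /Z /base; lia.
have h4 := @exec_move_loop K (aux M) s3 _ _ KZ K0 isT.
rewrite s3Z size_rev revK in h4; set s4 := upd _ 0 _ in h4.
have h5 := hoare_Embed leK run.
apply: hoare_weak (hoare_Seq h1 (hoare_Seq h2 (hoare_Seq h3 (hoare_Seq h4
  (hoare_Seq (hoare_weak _ (leqnn _) _ h5) (hoare_Check _ _ y)))))) => //.
- by rewrite /T !leq_add2l leq_add2r ltnS leq_mul2r.
- by move=> ts ->; rewrite Ly.
- move=> ts rts; apply: (embeds_init leK rts).
    by rewrite /s4 /s3 /s2 /upd /= cats0.
  move=> i /andP[i0 im]; rewrite /s4 /upd gtn_eqF //; case: eqP => // /eqP iZ.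
  by rewrite /s3 /upd (negPf iZ) /s2 /upd ifN // /base; lia.
Qed.

(** * P is contained in NP *)

Fixpoint decode (z : word) : word :=
  if z is true :: b :: z' then b :: decode z' else [::].

Lemma decode_pair_word x w : decode (pair_word x w) = x.
Proof. by rewrite /pair_word /delimit; elim: x => //= b x ->. Qed.

Section Decode.
Variables (K : nat) (A : finType).

Definition drain i : fragment K A := While i Skip Skip.

Lemma exec_drain sigma i : i <= K ->
  exec sigma (drain i) (size (sigma i) * 2).+1 (upd sigma i [::]).
Proof.
move=> iK; move: {2}(sigma i) (erefl (sigma i)) => w.
elim: w sigma => [|b w IHw] sigma si; rewrite si /=.
  apply: (exec_ext (exec_While_nil _ _ iK si)) => // k.
  by rewrite /upd; case: eqP => // ->.
have E : upd sigma i w i = w by rewrite /upd eqxx.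
have h := IHw _ E; rewrite E in h.
have hb : exec (upd sigma i w) (if b then Skip else Skip : fragment K A) 1 (upd sigma i w).
  by case: (b); exact: exec_Skip.
apply: (exec_ext (exec_While_cons iK si hb h)) => // k.
by rewrite /upd; case: eqP.
Qed.

(** The delimiter [false] ends the loop by draining stack [i], which also clears that tape for the
    decoded word. *)
Definition Decode i j : fragment K A :=
  While i (Case i (Push j true) (Push j false) Skip) (drain i).

Lemma exec_Decode sigma i j : i <= K -> j <= K -> i != j ->
  exec sigma (Decode i j) (size (sigma i) * 6).+1
    (upd (upd sigma i [::]) j (rev (decode (sigma i)) ++ sigma j)).
Proof.
(* Strong induction, as one iteration consumes two bits. *)
move=> iK jK ij; have [n] := ubnP (size (sigma i)).
elim: n sigma => // n IHn sigma; case si: (sigma i) => [|[] z] /=.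
- move=> _; apply: (exec_ext (exec_While_nil _ _ iK si)) => // k; rewrite /upd.
  by case: eqP => [->//|_]; case: eqP => [->|].
- case: z si => [|b z] si.
    have E : upd sigma i [::] i = [::] by rewrite /upd eqxx.
    have hc := exec_Case_nil (A := A) (Push j true) (Push j false) iK E (exec_Skip _).
    move=> _; apply: (exec_le (n := 4)) => //.
    apply: (exec_ext (exec_While_cons iK si hc (exec_While_nil _ _ iK E))) => // k.
    rewrite /upd; have [->|//] := eqVneq k j.
    by rewrite [j == i]eq_sym (negPf ij).
  rewrite !ltnS /= => zn.
  pose s1 := upd sigma i (b :: z); pose s2 := upd s1 i z.
  have E1 : s1 i = b :: z by rewrite /s1 /upd eqxx.
  have hp : exec s2 (if b then Push j true else Push j false : fragment K A) 2
      (upd s2 j (b :: s2 j)).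
    by case: (b); exact: exec_Push.
  have hc := exec_Case_cons Skip iK E1 hp.
  set s3 := upd s2 j _ in hc.
  have E3 : s3 i = z by rewrite /s3 /upd (negPf ij) /s2 /upd eqxx.
  have /IHn h : size (s3 i) < n by rewrite E3 ltnW.
  rewrite E3 in h.
  apply: (exec_le (n := (3 + (size z * 6).+1).+1)); last by lia.
  apply: (exec_ext (exec_While_cons iK si hc h)) => // k.
  rewrite /s3 /s2 /s1 /upd eqxx [j == i]eq_sym (negPf ij).
  by case: eqP => [_|_]; [rewrite rev_cons cat_rcons | case: eqP].
- move=> _; have E : upd sigma i z i = z by rewrite /upd eqxx.
  have hd := exec_drain (upd sigma i z) iK; rewrite E in hd.
  set s1 := upd _ i [::] in hd; have E1 : s1 i = [::] by rewrite /s1 /upd eqxx.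
  apply: (exec_le (n := ((size z * 2).+1 + 1).+1)); last by lia.
  apply: (exec_ext (exec_While_cons iK si hd (exec_While_nil _ _ iK E1))) => // k.
  rewrite /s1 /upd; have [->|kj] := eqVneq k j; last by case: eqP.
  by rewrite [j == i]eq_sym (negPf ij).
Qed.

End Decode.

Lemma in_P_decode (L : language) : in_P L -> in_P (fun z => L (decode z)).
Proof.
move=> [M [c hM]]; set m := extra_tapes M; pose K := m.+1.
have leK : m <= K by rewrite /K.
pose f := Seq (Decode K (aux M) 0 K) (Seq (move_loop _ _ K 0) (Embed M K)).
pose T n := (n * 6).+1 + ((n * 3).+1 + (n ^ c + c).+1).
apply: (@in_P_of_fragment _ _ f T).
  have pi := poly_bounded_id; have pc := poly_bounded_const.
  exact: poly_boundedD (poly_boundedS (poly_boundedM pi (pc 6))) (poly_boundedD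
    (poly_boundedS (poly_boundedM pi (pc 3)))
    (poly_boundedS (poly_boundedD (poly_boundedX c pi) (pc c)))).
move=> z; set x := decode z; have [y run Ly] := hM x.
have le_x n : size z <= n -> size (decode z) <= n.
  rewrite /x; elim: n z {x run Ly} => [|n IHn] [|[] [|b z]] //=.
  by rewrite !ltnS => zn; rewrite IHn // ltnW.
have {}le_x := le_x _ (leqnn _).
have h1 := @exec_Decode K (aux M) (input z) 0 K isT (leqnn _) isT.
have E0 : input z 0 = z by [].
have EK : input z K = [::] by [].
rewrite E0 EK cats0 in h1; set s1 := upd _ K _ in h1.
have h2 := @exec_move_loop K (aux M) s1 K 0 (leqnn K) isT isT.
have E1 : s1 K = rev x by rewrite /s1 /upd eqxx.
rewrite E1 revK size_rev in h2; set s2 := upd _ 0 _ in h2.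
have h3 : hoare (rep s2) (Embed M K) (size x ^ c + c).+1
    (fun ts => leading_bits (ts ord0).2 = y).
  apply: hoare_weak (hoare_Embed leK run) => // ts rts.
  apply: (embeds_init leK rts); first by rewrite /s2 /s1 /upd /= cats0.
  move=> i /andP[i0 im]; rewrite /s2 /s1 /input /upd !ifN //; lia.
apply: hoare_weak (hoare_Seq h1 (hoare_Seq h2 h3)) => //.
- rewrite /T leq_add2l leq_add ?ltnS ?leq_mul2r ?le_x ?orbT //.
  by rewrite leq_add2r leq_expl.
- by move=> ts ->; rewrite Ly.
Qed.

(** The verifier ignores the witness and decides [L] on the first component. *)
Lemma P_sub_NP (L : language) : in_P L -> in_NP L.
Proof.
move=> LP; exists (fun z => L (decode z)), 0; split; first exact: in_P_decode.
move=> x; split=> [Lx|[w _]]; last by rewrite decode_pair_word.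
by exists [::]; rewrite ?decode_pair_word.
Qed.

(** * Grids *)

(** Vertices are numbered row by row; the condition on [j %% cols] forbids a link from the end of a
    row to the start of the next. *)
Definition link (cols i j : nat) : bool :=
  (j == i + cols) || ((j == i.+1) && (j %% cols != 0)).

Lemma link_lt cols i j : 0 < cols -> link cols i j -> i < j.
Proof. by rewrite /link => ? /orP[/eqP|/andP[/eqP -> _]]; lia. Qed.

Lemma link_right cols i : i.+1 %% cols != 0 ->
  i.+1 %/ cols = i %/ cols /\ i.+1 %% cols = (i %% cols).+1.
Proof.
case: cols => [|cols]; first by rewrite !modn0.
rewrite modnS divnS // -/(dvdn _ _) => h; move: h; rewrite /dvdn.
by case: ifP => // _ _; rewrite add0n.
Qed.

Definition grid_adj (rows cols : nat) (i j : 'I_(rows * cols)) : bool :=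
  link cols i j || link cols j i.

Section GridPlanar.
Variables (R : realType) (rows cols : nat).
Hypothesis cols_gt1 : 1 < cols.
Local Open Scope ring_scope.
Local Open Scope classical_set_scope.

Let x (i : nat) : R := (i %% cols)%:R.
Let y (i : nat) : R := (i %/ cols)%:R.

Lemma grid_point_inj i j : x i = x j -> y i = y j -> i = j.
Proof.
move=> /eqP; rewrite eqr_nat => /eqP xij /eqP; rewrite eqr_nat => /eqP yij.
by rewrite (divn_eq i cols) yij xij -divn_eq.
Qed.

Lemma natD_frac_inj (m n : nat) (s t : R) : 0 < s < 1 -> 0 < t < 1 ->
  m%:R + s = n%:R + t -> m = n.
Proof.
move=> /andP[s0 s1] /andP[t0 t1] e.
have [mn|nm|//] := ltngtP m n.
- have : m.+1%:R <= n%:R :> R by rewrite ler_nat.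
  by rewrite -natr1 => h; exfalso; lra.
- have : n.+1%:R <= m%:R :> R by rewrite ler_nat.
  by rewrite -natr1 => h; exfalso; lra.
Qed.

Lemma natD_frac_neq (m n : nat) (s : R) : 0 < s < 1 -> m%:R + s <> n%:R.
Proof.
move=> /andP[s0 s1] e.
have [mn|nm] := ltnP m n.
- have : m.+1%:R <= n%:R :> R by rewrite ler_nat.
  by rewrite -natr1 => h; exfalso; lra.
- have : n%:R <= m%:R :> R by rewrite ler_nat.
  lra.
Qed.

(** Arcs are unit segments between integer points. An interior point has exactly one non-integral
    coordinate, which gives the direction of the segment; the integral parts give its starting
    point. *)
Lemma grid_planar : planar R (@grid_adj rows cols).
Proof.
have cols_gt0 : (0 < cols)%N by exact: ltnW.
pose pt (i : 'I_(rows * cols)) := (x i, y i).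
pose arc (i j : 'I_(rows * cols)) (t : R) :=
  if j == i.+1 :> nat then (x i + t, y i) else (x i, y i + t).
have edge_link (i j : 'I_(rows * cols)) :
    (i < j)%N && grid_adj i j -> link cols i j.
  case/andP=> ij /orP[//|/(link_lt cols_gt0)]; lia.
have pt_inj : injective pt.
  by move=> i j [xij yij]; apply: val_inj; exact: grid_point_inj.
exists pt, arc => edge; split=> //.
- move=> i j /edge_link ij; split.
  + apply: continuous_subspaceT => t; rewrite /arc.
    case: (j == i.+1 :> nat).
      apply: (@cvg_pair _ _ _ (nbhs t) (nbhs (x i + t)) (nbhs (y i)) _ _ _
        (fun t => x i + t) (fun=> y i)); last exact: cvg_cst.
      by apply: cvgD; [exact: cvg_cst | exact: cvg_id].
    apply: (@cvg_pair _ _ _ (nbhs t) (nbhs (x i)) (nbhs (y i + t)) _ _ _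
      (fun=> x i) (fun t => y i + t)); first exact: cvg_cst.
    by apply: cvgD; [exact: cvg_cst | exact: cvg_id].
  + move=> s t _ _; rewrite /arc.
    by case: ifP => _ [h]; exact: (addrI _ h).
  + by rewrite /arc; case: ifP => _; rewrite addr0.
  + rewrite /arc /pt; move: ij; rewrite /link; case/orP=> [/eqP ij|/andP[/eqP ij jm]].
      (* By [cols_gt1] a vertical neighbour is never [i.+1], so the test in [arc] does tell the
         directions apart. *)
      rewrite ij ifF; last by lia.
      rewrite /x /y modnDr divnDr ?dvdnn // divnn cols_gt0 natrD.
      by [].
    rewrite ij eqxx; move: jm; rewrite /x /y ij => /link_right[-> ->].
    by rewrite -natr1.
- move=> i j k t _ t01; rewrite /arc /pt; case: ifP => _ [].
  + by move=> e _; exact: natD_frac_neq t01 e.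
  + by move=> _ e; exact: natD_frac_neq t01 e.
- move=> i j k l s t /edge_link ij /edge_link kl s01 t01; rewrite /arc.
  have jE : j = (if j == i.+1 :> nat then i.+1 else i + cols)%N :> nat.
    by move: ij; rewrite /link; case: ifP => [/eqP|_ /orP[/eqP|]].
  have lE : l = (if l == k.+1 :> nat then k.+1 else k + cols)%N :> nat.
    by move: kl; rewrite /link; case: ifP => [/eqP|_ /orP[/eqP|]].
  have fin : val i = val k -> (j == i.+1 :> nat) = (l == k.+1 :> nat) ->
      (i, j) = (k, l).
    move=> ik e; have {}ik : i = k by exact: val_inj.
    congr (_, _) => //; apply: val_inj.
    by rewrite /= jE lE e ik.
  case: ifP fin => _; case: ifP => _ fin [].
  + move=> /(natD_frac_inj s01 t01) xik yik; apply: fin => //.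
    by apply: grid_point_inj => //; rewrite /x xik.
  + by move=> e _; case: (natD_frac_neq s01 e).
  + by move=> e _; case: (natD_frac_neq t01 (esym e)).
  + move=> xik /(natD_frac_inj s01 t01) yik; apply: fin => //.
    by apply: grid_point_inj => //; rewrite /y yik.
Qed.

End GridPlanar.

(** * Constraint satisfaction on grids as energy minimization *)

Section GridInstance.
Variables (rows cols : nat) (D : finType).
Variables (vok : nat -> pred D) (right_ok down_ok : rel D).
Hypothesis cols_gt1 : 1 < cols.

Let cols_gt0 : 0 < cols. Proof. exact: ltnW. Qed.

Definition grid_solution (rho : nat -> D) : Prop :=
  (forall i, i < rows * cols -> vok i (rho i)) /\
  (forall i j, j < rows * cols -> link cols i j ->
     (if j == i.+1 then right_ok else down_ok) (rho i) (rho j)).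

(* Label 0 means giving up: it must then be used everywhere, at total cost 1. *)
Definition label_value (a : 'I_#|D|.+1) : option D :=
  omap enum_val (unlift ord0 a).
Definition value_label (d : D) : 'I_#|D|.+1 := lift ord0 (enum_rank d).

Lemma value_labelK d : label_value (value_label d) = Some d.
Proof. by rewrite /label_value /value_label liftK /= enum_rankK. Qed.

Lemma label_value0 : label_value ord0 = None.
Proof. by rewrite /label_value unlift_none. Qed.

Lemma label_value_None a : label_value a = None -> a = ord0.
Proof. by rewrite /label_value; case: unliftP => [j ->|->]. Qed.

Local Open Scope ereal_scope.

Definition vertex_cost (c : \bar rat) (p : pred D) (a : 'I_#|D|.+1) : \bar rat :=
  if label_value a is Some d then (if p d then 0 else +oo) else c.

Definition edge_cost (r : rel D) (a b : 'I_#|D|.+1) : \bar rat :=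
  match label_value a, label_value b with
  | Some d, Some d' => if r d d' then 0 else +oo
  | None, None => 0
  | _, _ => +oo
  end.

(** Giving up is charged at vertex 0 only, so doing it everywhere costs 1. Nonnegative potentials
    with weights 1/2 make all local energies nonnegative. Swapping the arguments for [i > j] gives
    both orientations of an edge the same function. *)
Definition grid_instance : instance :=
  @Instance #|D|.+1 (rows * cols) (@grid_adj rows cols)
    (fun i a => vertex_cost (if i == 0%N :> nat then 1 else 0) (vok i) a)
    (fun i j a b =>
       if (i < j)%N then edge_cost (if j == i.+1 :> nat then right_ok else down_ok) a b
       else edge_cost (if i == j.+1 :> nat then right_ok else down_ok) b a)
    (fun _ _ => (2%:R^-1)%R).

Lemma vertex_cost_ge0 c p a : 0 <= c -> 0 <= vertex_cost c p a.
Proof. by rewrite /vertex_cost; case: label_value => // d; case: ifP. Qed.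

Lemma edge_cost_ge0 r a b : 0 <= edge_cost r a b.
Proof.
by rewrite /edge_cost; case: label_value => [d|]; case: label_value => [d'|] //;
  case: ifP.
Qed.

Lemma grid_vpot_ge0 i a : 0 <= @vpot grid_instance i a.
Proof. by apply: vertex_cost_ge0; case: ifP. Qed.

Lemma grid_epot_ge0 i j a b : 0 <= @epot grid_instance i j a b.
Proof. by rewrite /=; case: ifP => _; exact: edge_cost_ge0. Qed.

Lemma grid_adj_neq (i j : 'I_(rows * cols)) : grid_adj i j -> i != j :> nat.
Proof. by case/orP=> /(link_lt cols_gt0); lia. Qed.

Lemma grid_valid (R : realType) : valid_instance R grid_instance.
Proof.
have ge0N (e : \bar rat) : 0 <= e -> e != -oo by case: e.
split=> //.
- split; last exact: grid_planar.
  + by move=> i j; rewrite /= /grid_adj orbC.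
  + by move=> i; apply/negP => /grid_adj_neq; rewrite eqxx.
- split=> [i a|i j a b _|i j a b /grid_adj_neq].
  + exact/ge0N/grid_vpot_ge0.
  + exact/ge0N/grid_epot_ge0.
  + by rewrite /=; case: ltngtP.
- move=> i s; apply: adde_ge0; first exact: grid_vpot_ge0.
  by apply: sume_ge0 => j _; apply: mule_ge0; [|exact: grid_epot_ge0].
Qed.

Lemma optimum_le (s : labelling grid_instance) : optimum grid_instance <= energy s.
Proof. by rewrite /optimum; exact: bigmin_le_cond. Qed.

Lemma grid_energy0 rho : grid_solution rho ->
  energy ([ffun i => value_label (rho (val i))] : labelling grid_instance) = 0.
Proof.
move=> [hv he]; rewrite /energy !big1 ?adde0 // => i _.
- rewrite big1 // => j /andP[ij aij]; rewrite !ffunE /= ij /edge_cost !value_labelK.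
  rewrite he //; case/orP: aij => // /(link_lt cols_gt0) ji.
  by have := ltn_trans ij ji; rewrite ltnn.
- by rewrite ffunE /= /vertex_cost value_labelK hv.
Qed.

Lemma sume_ge_term (I : finType) (P : pred I) (F : I -> \bar rat) i :
  P i -> (forall j, P j -> 0 <= F j) -> F i <= \sum_(j | P j) F j.
Proof.
move=> Pi F0; rewrite (bigD1 i) //= leeDl //.
by apply: sume_ge0 => j /andP[/F0].
Qed.

(** All terms are nonnegative, so finite energy makes each of them finite; hard constraints are read
    off in this way. *)
Lemma energy_vpot_le (s : labelling grid_instance) i : vpot i (s i) <= energy s.
Proof.
apply: (le_trans _ (leeDl _ _)); last first.
  by apply: sume_ge0 => k _; apply: sume_ge0 => j _; exact: grid_epot_ge0.
apply: (@sume_ge_term _ xpredT (fun i => vpot i (s i))) => // j _.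
exact: grid_vpot_ge0.
Qed.

Lemma energy_epot_le (s : labelling grid_instance) (i j : 'I_(rows * cols)) :
  (i < j)%N -> grid_adj i j ->
  @epot grid_instance i j (s i) (s j) <= energy s.
Proof.
move=> ij aij; apply: (le_trans _ (leeDr _ _)); last first.
  by apply: sume_ge0 => k _; exact: grid_vpot_ge0.
pose F k l := @epot grid_instance k l (s k) (s l).
have F0 k l : 0 <= F k l by exact: grid_epot_ge0.
have le1 : F i j <= \sum_(l < rows * cols | (i < l)%N && grid_adj i l) F i l.
  by apply: (@sume_ge_term _ _ (F i)); rewrite ?ij.
apply: le_trans le1 _.
apply: (@sume_ge_term _ xpredT (fun k : 'I_(rows * cols) =>
  \sum_(l < rows * cols | (k < l)%N && grid_adj k l) F k l)) => // k _.
by apply: sume_ge0.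
Qed.

(** Giving up everywhere has finite energy; without this the approximation guarantee would be void
    on unsolvable grids. *)
Lemma optimum_lt_pinfty : optimum grid_instance < +oo.
Proof.
apply: le_lt_trans (optimum_le [ffun=> ord0]) _.
rewrite /energy lte_add_pinfty //; apply: lte_sum_pinfty => i _.
  by rewrite ffunE /= /vertex_cost label_value0; case: ifP.
apply: lte_sum_pinfty => j _; rewrite !ffunE /=; case: ifP => _;
  by rewrite /edge_cost label_value0.
Qed.

(** If a solution exists, the optimum is 0, so [s] has energy at most 0 and cannot pay 1 at [i0].
    Conversely the energy of [s] is finite, so not giving up at [i0] spreads over the whole grid and
    all constraints hold. *)
Lemma grid_reduction (s : labelling grid_instance) (i0 : 'I_(rows * cols)) :
  i0 = 0%N :> nat -> energy s <= 2%:E * optimum grid_instance ->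
  (s i0 != ord0 <-> exists rho, grid_solution rho).
Proof.
move=> i00 hs; split=> [s0|[rho hrho]]; last first.
  apply/eqP => s0.
  have opt0 : optimum grid_instance <= 0.
    by rewrite -(grid_energy0 hrho); exact: optimum_le.
  have := le_trans (le_trans (energy_vpot_le s i0) hs) (mule_ge0_le0 _ opt0).
  by rewrite /= s0 i00 /= /vertex_cost label_value0 => /(_ isT).
have fin : energy s < +oo.
  by apply: le_lt_trans hs _; apply: lte_mul_pinfty => //; exact: optimum_lt_pinfty.
have efin (i j : 'I_(rows * cols)) (ij : (i < j)%N) (aij : grid_adj i j) :
    edge_cost (if j == i.+1 :> nat then right_ok else down_ok) (s i) (s j) < +oo.
    by have := le_lt_trans (energy_epot_le s ij aij) fin; rewrite /= ij.
have sN (i : 'I_(rows * cols)) : s i != ord0.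
  case: i => i; elim/ltn_ind: i => i IHi iM.
  have [i_eq0|i_gt0] := posnP i.
    by rewrite (_ : Ordinal iM = i0) //; apply: val_inj; rewrite /= i00.
  (* A smaller neighbour: the left one in row 0, the upper one elsewhere. An edge with exactly one
     end giving up costs [+oo]. *)
  have [k ki] : exists k, link cols k i.
    have [ilt|ige] := ltnP i cols.
      exists i.-1; rewrite /link prednK // eqxx modn_small //.
      by rewrite -lt0n i_gt0 orbT.
    by exists (i - cols)%N; rewrite /link subnK // eqxx.
  have klt := link_lt cols_gt0 ki.
  have kM := ltn_trans klt iM; have sk := IHi k klt kM.
  have := efin (Ordinal kM) (Ordinal iM) klt; rewrite /grid_adj /= ki => /(_ isT).
  rewrite /edge_cost; case E: label_value => [d|]; last first.
    by rewrite (label_value_None E) eqxx in sk.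
  by case E': label_value => // _; apply: contra_eqN E' => /eqP ->; rewrite label_value0.
(* A default value is needed because [rho] is defined on all of [nat]; the label of [i0] supplies
   one. *)
have [d0 _] : exists d : D, True.
  case E: (label_value (s i0)) => [d|]; first by exists d.
  by rewrite (label_value_None E) eqxx in s0.
pose rho i := if insub i is Some k then odflt d0 (label_value (s k)) else d0.
have rhoE (k : 'I_(rows * cols)) : label_value (s k) = Some (rho k).
  rewrite /rho valK; case E: label_value => [d|] //.
  by have := sN k; rewrite (label_value_None E) eqxx.
exists rho; split=> [i iM|i j jM ij].
  have := le_lt_trans (energy_vpot_le s (Ordinal iM)) fin.
  by rewrite /= /vertex_cost rhoE; case: ifP.
have ilt := link_lt cols_gt0 ij; have iM := ltn_trans ilt jM.
have := efin (Ordinal iM) (Ordinal jM) ilt; rewrite /grid_adj /= ij => /(_ isT).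
by rewrite /edge_cost !rhoE /=; case: ifP => // ->.
Qed.

End GridInstance.

(** * Computation tableaux as grid constraints *)

(* Position of a cell relative to a head: None means under the head, Some false
   to its left and Some true to its right. *)
Definition mark_at (h p : nat) : option bool :=
  if p == h then None else Some (h < p).

(** A left mark is never followed by a right mark, so the head cannot be skipped; nor can it occur
    twice. *)
Definition mark_next (m m' : option bool) : bool :=
  match m, m' with
  | Some false, Some false | Some false, None => true
  | None, Some true | Some true, Some true => true
  | _, _ => false
  end.

(** Seeing one column only, this rule leaves open whether a cell on the side of the move becomes the
    head; [mark_next] in the new row settles it. *)
Definition mark_move (v : move) (m m' : option bool) : bool :=
  match v, m with
  | Stay, _ => m' == m
  | MoveRight, Some true => m' != Some false
  | MoveRight, _ => m' == Some false
  | MoveLeft, Some false => m' != Some true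
  | MoveLeft, _ => m' == Some true
  end.

Definition move_head (v : move) (h : nat) : nat :=
  match v with MoveLeft => h.-1 | Stay => h | MoveRight => h.+1 end.

Lemma mark_next_at h p : mark_next (mark_at h p) (mark_at h p.+1).
Proof. by rewrite /mark_at; case: (ltngtP p h); case: (ltngtP p.+1 h) => //=; lia. Qed.

Lemma mark_move_at v h p : 0 < h ->
  mark_move v (mark_at h p) (mark_at (move_head v h) p).
Proof.
rewrite /mark_at; case: v => h0 /=.
- by case: (ltngtP p h); case: (ltngtP p h.-1) => //=; lia.
- by case: (ltngtP p h) => //=; rewrite eqxx.
- by case: (ltngtP p h); case: (ltngtP p h.+1) => //=; lia.
Qed.

Lemma marks_unique n (m : nat -> option bool) h :
  (forall p, p.+1 < n -> mark_next (m p) (m p.+1)) -> h < n -> m h = None ->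
  forall p, p < n -> m p = mark_at h p.
Proof.
move=> hm hn mh p pn; rewrite /mark_at; have [ph|hp|->//] := ltngtP p h.
- suff H d : d < h -> m (h - d.+1) = Some false.
    by have := H (h - p.+1); rewrite subnSK // subKn ?(ltnW ph) //; apply; lia.
  elim: d => [|d IHd] dh.
    have := hm (h - 1); rewrite -subSn // subSS subn0 mh => /(_ hn).
    by case: (m (h - 1)) => [[]|].
  have := hm (h - d.+2); rewrite -subSn // subSS IHd ?(ltnW dh) // => /(_ _).
  move=> /(_ (leq_ltn_trans (leq_subr _ _) hn)).
  by case: (m (h - d.+2)) => [[]|].
- suff H d : h + d.+1 < n -> m (h + d.+1) = Some true.
    by have := H (p - h.+1); rewrite addnS -addSn subnKC //; apply.
  elim: d => [|d IHd] hd.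
    rewrite addn1 in hd *; have := hm h hd; rewrite mh.
    by case: (m h.+1) => [[]|].
  rewrite addnS in hd *; have := hm _ hd; rewrite IHd ?(ltnW hd) //.
  by case: (m (h + d.+1).+1) => [[]|].
Qed.

(** On a move to the right, cell [h] becomes a left cell and [h.+1] is not left; a right mark cannot
    follow a left one, so [h.+1] carries the head. The other direction is symmetric, and the bounds
    on [h] keep both neighbours inside the row. *)
Lemma mark_move_head n (m m' : nat -> option bool) v h :
  (forall p, p < n -> m p = mark_at h p) ->
  (forall p, p < n -> mark_move v (m p) (m' p)) ->
  (forall p, p.+1 < n -> mark_next (m' p) (m' p.+1)) ->
  0 < h -> h.+1 < n -> forall p, p < n -> m' p = mark_at (move_head v h) p.
Proof.
move=> hm hv hm' h0 hn; apply: marks_unique => //.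
  by case: v {hv} => /=; lia.
have hn' := ltnW hn.
have := hv h hn'; rewrite hm // {1}/mark_at eqxx.
case: v hv => /= hv; last first.
- move=> /eqP mh; have := hv h.+1 hn; rewrite hm // /mark_at gtn_eqF // ltnSn.
  by have := hm' h hn; rewrite mh; case: (m' h.+1) => [[]|].
- by move=> /eqP.
- move=> /eqP mh; have hp : h.-1 < n by lia.
  have := hv h.-1 hp; rewrite hm // /mark_at ltn_eqF ?prednK // ltnNge leq_pred /=.
  by have := hm' h.-1; rewrite prednK // mh => /(_ hn'); case: (m' h.-1) => [[]|].
Qed.

(** * Tape contents by absolute column *)

Section Content.
Variable A : finType.
Implicit Types t : tape A.

(** The two lists are relative to the head. With [h] the column of the head, a cell keeps its column
    [p] when the head moves. *)
Definition content t h p : symbol A :=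
  if p < h then nth None t.1 (h - p).-1 else nth None t.2 (p - h).

Lemma content_head t h : content t h h = scan t.
Proof. by rewrite /content ltnn subnn scanE. Qed.

Lemma content_write_move a v t h p : 0 < h ->
  content (write_move (a, v) t) (move_head v h) p =
  if p == h then a else content t h p.
Proof.
case: t v => l r [] h0; rewrite /content /=.
- have [ph|hp|->] := ltngtP p h.
  + have [ph1|hp1|->] := ltngtP p h.-1; last 1 first.
    * by rewrite subnn /= -nth0; congr nth; lia.
    * by rewrite nth_behead; congr nth; lia.
    * lia.
  + rewrite ifF; last by lia.
    rewrite (_ : p - h.-1 = (p - h.+1).+2) /=; last by lia.
    by rewrite nth_behead; congr nth; lia.
  + rewrite ifF; last by lia.
    by rewrite (_ : h - h.-1 = 1); last by lia.
- have [ph|hp|->] := ltngtP p h => //; last by rewrite subnn.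
  rewrite (_ : p - h = (p - h.+1).+1) /=; last by lia.
  by rewrite nth_behead.
- have [ph|hp|->] := ltngtP p h.
  + rewrite ifT; last by lia.
    by rewrite (_ : (h.+1 - p).-1 = (h - p).-1.+1); last by lia.
  + rewrite ifF; last by lia.
    by rewrite nth_behead; congr nth; lia.
  + by rewrite ltnSn subSnn.
Qed.

Definition is_bit (s : symbol A) : bool := if s is Some (inl _) then true else false.

(** Makes acceptance local: the scanned cell and its right neighbour decide it. *)
Lemma leading_bits_true r : (leading_bits r = [:: true]) <->
  nth None r 0 = Some (inl true) /\ ~~ @is_bit (nth None r 1).
Proof.
case: r => [|[[[]|a]|] r] /=; try by split=> [//|[]].
by case: r => [|[[b|a]|] r]; split=> [|[]].
Qed.

Lemma nth_cells z q : nth None (cells A z) q =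
  if q < size z then Some (inl (nth false z q)) else None.
Proof.
have [qz|zq] := ltnP q (size z); first by rewrite (nth_map false).
by rewrite nth_default // size_map.
Qed.

(** Serves to read the witness off row 0: bits followed by nothing but blanks form a word. *)
Lemma nth_leading_bits (r : seq (symbol A)) :
  (forall q, is_bit (nth None r q) || (nth None r q == None)) ->
  (forall q, nth None r q = None -> nth None r q.+1 = None) ->
  nth None r =1 nth None (cells A (leading_bits r)).
Proof.
elim: r => [|a r IHr] hb hN; first by [].
have {}IHr := IHr (fun q => hb q.+1) (fun q => hN q.+1).
case: a hb hN => [[b|a]|] hb hN; last 1 first.
- have H q : nth None (None :: r) q = None by elim: q => // q; exact: hN.
  by move=> q; rewrite H /= nth_nil.
- by case=> [|q] //=.
- by have := hb 0.
Qed.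

End Content.

(** * Labels and local rules of the tableau *)

Section Tableau.
Variable M : machine.
Let A := aux M.
Let I := 'I_(extra_tapes M).+1.

(* A label of the cell at column p and time t records whether t = 0, the state
   and the scanned symbols at time t, and for each tape the content of cell p and
   its position relative to the head. *)
Definition tcell : finType :=
  (bool * state M * {ffun I -> symbol A} * {ffun I -> symbol A * option bool})%type.

Definition is_first (d : tcell) : bool := d.1.1.1.
Definition cstate (d : tcell) : state M := d.1.1.2.
Definition scanned (d : tcell) : {ffun I -> symbol A} := d.1.2.
Definition sym (d : tcell) (j : I) : symbol A := (d.2 j).1.
Definition mark (d : tcell) (j : I) : option bool := (d.2 j).2.

(** Halted configurations repeat, as under [step], so computations of any length up to [T] fill the
    same number of rows. *)
Definition next (s : state M) (a : {ffun I -> symbol A}) :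
    state M * (I -> symbol A * move) :=
  if halting s then (s, fun j => (a j, Stay)) else trans s a.

(** The first clause makes the [scanned] symbols, which are merely shared along a row, agree with
    the cells under the heads. The second describes initial configurations. *)
Definition cell_ok : pred tcell := fun d =>
  [forall j, (mark d j == None) ==> (sym d j == scanned d j)] &&
  (is_first d ==>
    [&& cstate d == @start M, [forall j, (j != ord0) ==> (sym d j == None)],
        is_bit (sym d ord0) || (sym d ord0 == None)
      & (mark d ord0 == Some false) ==> (sym d ord0 == None)]).

(** In row 0 blanks persist from the head to the right, so the input tape carries a single word. The
    last clause demands the output [[:: true]] in every halted row. *)
Definition right_ok : rel tcell := fun d d' =>
  [&& is_first d == is_first d', cstate d == cstate d', scanned d == scanned d',
      [forall j, mark_next (mark d j) (mark d' j)],
      is_first d ==> (mark d ord0 != Some false) ==> (sym d ord0 == None) ==>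
        (sym d' ord0 == None)
    & halting (cstate d) ==> (mark d ord0 == None) ==>
        (sym d ord0 == Some (inl true)) && ~~ is_bit (sym d' ord0)].

Definition down_ok : rel tcell := fun d d' =>
  let: (s, act) := next (cstate d) (scanned d) in
  [&& ~~ is_first d', cstate d' == s
    & [forall j, (sym d' j == if mark d j == None then (act j).1 else sym d j) &&
         mark_move (act j).2 (mark d j) (mark d' j)]].

Implicit Types (c : configuration M) (h : I -> nat).

Definition scans_of c : {ffun I -> symbol A} := [ffun j => scan (c.2 j)].

Definition cell_of (f : bool) c h p : tcell :=
  (f, c.1, scans_of c, [ffun j => (content (c.2 j) (h j) p, mark_at (h j) p)]).

Lemma sym_cell_of f c h p j : sym (cell_of f c h p) j = content (c.2 j) (h j) p.
Proof. by rewrite /sym ffunE. Qed.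

Lemma mark_cell_of f c h p j : mark (cell_of f c h p) j = mark_at (h j) p.
Proof. by rewrite /mark ffunE. Qed.

Definition head_step c h : I -> nat :=
  fun j => move_head ((next c.1 (scans_of c)).2 j).2 (h j).

Lemma step_state c : (step c).1 = (next c.1 (scans_of c)).1.
Proof. by rewrite /step /next; case: halting => //; case: trans. Qed.

Lemma step_content c h j p : 0 < h j ->
  content ((step c).2 j) (head_step c h j) p =
  if p == h j then ((next c.1 (scans_of c)).2 j).1 else content (c.2 j) (h j) p.
Proof.
move=> h0; rewrite /step /head_step /next; case: halting => /=.
  by rewrite ffunE; case: eqP => // ->; rewrite content_head.
rewrite -/(scans_of c); case: trans => s act /=; rewrite ffunE.
by case: (act j) => a v /=; rewrite content_write_move.
Qed.

Lemma down_ok_step f c h p : (forall j, 0 < h j) ->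
  down_ok (cell_of f c h p) (cell_of false (step c) (head_step c h) p).
Proof.
move=> h0; rewrite /down_ok /is_first /cstate /scanned /=.
have := step_state c; have := @step_content c h; rewrite /head_step.
case: next => s act /= hc ->; rewrite eqxx /=; apply/forallP => j.
rewrite !sym_cell_of !mark_cell_of hc // mark_move_at // andbT.
by rewrite /mark_at; case: (p =P h j).
Qed.

Lemma row_const n (rho : nat -> tcell) :
  (forall p, p.+1 < n -> right_ok (rho p) (rho p.+1)) ->
  forall p q, p < n -> q < n ->
  [/\ is_first (rho p) = is_first (rho q), cstate (rho p) = cstate (rho q)
    & scanned (rho p) = scanned (rho q)].
Proof.
move=> hr; suff H p : p < n -> [/\ is_first (rho p) = is_first (rho 0),
    cstate (rho p) = cstate (rho 0) & scanned (rho p) = scanned (rho 0)].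
  by move=> p q /H[-> -> ->] /H[-> -> ->].
elim: p => // p IHp pn; have [<- <- <-] := IHp (ltnW pn).
by have /and5P[/eqP -> /eqP -> /eqP -> _ _] := hr p pn.
Qed.

Lemma tcell_ext (d d' : tcell) : is_first d = is_first d' -> cstate d = cstate d' ->
  scanned d = scanned d' -> (forall j, sym d j = sym d' j) ->
  (forall j, mark d j = mark d' j) -> d = d'.
Proof.
case: d d' => [[[f s] a] g] [[[f' s'] a'] g'] /=.
rewrite /is_first /cstate /scanned /sym /mark /= => -> -> -> hs hm.
by congr (_, _); apply/ffunP => j; rewrite [LHS]surjective_pairing hs hm -surjective_pairing.
Qed.

(** A row determines the next: [down_ok] fixes state and contents, and [mark_move_head] the marks.
    It does not constrain [scanned] below, which is recovered from the cells under the new heads. *)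
Lemma row_step n (rho rho' : nat -> tcell) f c h :
  (forall p, p < n -> rho p = cell_of f c h p) ->
  (forall p, p < n -> down_ok (rho p) (rho' p)) ->
  (forall p, p.+1 < n -> right_ok (rho' p) (rho' p.+1)) ->
  (forall p, p < n -> cell_ok (rho' p)) ->
  (forall j, 0 < h j /\ (h j).+1 < n) ->
  forall p, p < n -> rho' p = cell_of false (step c) (head_step c h) p.
Proof.
move=> hrho hd hr hok hh.
have down p : p < n -> [/\ is_first (rho' p) = false, cstate (rho' p) = (step c).1,
    (forall j, sym (rho' p) j = content ((step c).2 j) (head_step c h j) p)
    & (forall j, mark_move ((next c.1 (scans_of c)).2 j).2 (mark_at (h j) p)
         (mark (rho' p) j))].
  move=> pn; have := hd p pn; rewrite hrho // /down_ok /= step_state.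
  have sc := @step_content c h; move: sc; rewrite /head_step.
  rewrite /scanned /cstate /=; case: next => s act /= sc.
  move=> /and3P[/negPf -> /eqP -> /forallP hj]; split=> // j.
    have /andP[/eqP -> _] := hj j; have [h0 _] := hh j.
    rewrite sc // sym_cell_of mark_cell_of /mark_at.
    by case: (p =P h j).
  by have /andP[_] := hj j; rewrite mark_cell_of.
have marks p j : p < n -> mark (rho' p) j = mark_at (head_step c h j) p.
  move: p; apply: (@mark_move_head n (mark_at (h j)) (fun p => mark (rho' p) j)) => //.
  - by move=> p /down[].
  - by move=> p /hr /and5P[_ _ _ /forallP].
  - by have [] := hh j.
  - by have [] := hh j.
have hn j : head_step c h j < n.
  by have [] := hh j; rewrite /head_step; case: (next _ _).2 => _ [] /=; lia.
move=> p pn; have [fp sp cp _] := down p pn.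
apply: tcell_ext => //.
(* For each tape [j], compare with the column of its own head, where [cell_ok] applies. *)
- apply/ffunP => j; have [_ _ ->] := row_const hr pn (hn j).
  have /andP[/forallP /(_ j) /implyP ok _] := hok _ (hn j).
  have [_ _ symh _] := down _ (hn j).
  rewrite -(eqP (ok _)) ?marks ?/mark_at ?eqxx //.
  by rewrite symh content_head ffunE.
- by move=> j; rewrite cp sym_cell_of.
- by move=> j; rewrite marks // mark_cell_of.
Qed.

(** Vertex constraints depend on the position only through these finitely many kinds, so their
    encoded potentials can be constants of a generator. *)
Inductive kind := KAny | KLeft | KBit of bool | KBlank | KHalt.

(** [KLeft] followed by [KBit] pins all heads to the first bit: right after a left mark comes a left
    mark or the head, and [KBit] excludes the former. *)
Definition kind_ok (k : kind) : pred tcell := fun d =>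
  cell_ok d &&
  match k with
  | KAny => true
  | KLeft => is_first d && [forall j, mark d j == Some false]
  | KBit b => (sym d ord0 == Some (inl b)) && [forall j, mark d j != Some false]
  | KBlank => sym d ord0 == None
  | KHalt => halting (cstate d)
  end.

(* Row 0 carries u from column b.+1 on, then at most k more bits. *)
Definition kinds (b : nat) (u : word) (k r : nat) : seq kind :=
  nseq b KAny ++ KLeft :: map KBit u ++ nseq k KAny ++ KBlank :: nseq r KAny ++
  [:: KHalt].

Lemma nth_kinds b u k r i : nth KAny (kinds b u k r) i =
  if i < b then KAny else if i == b then KLeft
  else if i < b.+1 + size u then KBit (nth false u (i - b.+1))
  else if i < b.+1 + size u + k then KAny
  else if i == b.+1 + size u + k then KBlank
  else if i == b.+1 + size u + k + r.+1 then KHalt else KAny.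
Proof.
rewrite /kinds nth_cat size_nseq nth_nseq; have [ib|bi] := ltnP i b; first by [].
have [->|nib] := eqVneq i b; first by rewrite subnn.
rewrite (_ : i - b = (i - b.+1).+1) /=; last by lia.
rewrite nth_cat size_map; have [iu|ui] := ltnP i (b.+1 + size u).
  by rewrite ifT ?(nth_map false) //; lia.
rewrite ifF; last by lia.
rewrite nth_cat size_nseq nth_nseq; have [ik|ki] := ltnP i (b.+1 + size u + k).
  by rewrite !ifT //; lia.
rewrite ifF; last by lia.
have [->|nik] := eqVneq i (b.+1 + size u + k).
  by rewrite (_ : _ - k = 0) //; lia.
rewrite (_ : i - b.+1 - size u - k = (i - (b.+1 + size u + k).+1).+1) /=; last by lia.
rewrite nth_cat size_nseq nth_nseq.
have [->|nir] := eqVneq i (b.+1 + size u + k + r.+1).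
  rewrite ifF; last by lia.
  by rewrite (_ : _ - r = 0) //; lia.
case: ifP => ir; first by rewrite if_same.
have : 0 < i - (b.+1 + size u + k).+1 - r by lia.
by case: (_ - r) => [|n] //= _; rewrite nth_nil.
Qed.

Lemma size_kinds b u k r :
  size (kinds b u k r) = b.+1 + size u + k + r.+2.
Proof. by rewrite !size_cat /= !size_cat /= !size_cat /= size_map !size_nseq; lia. Qed.

Lemma init_content z j (h p : nat) : content ((init M z).2 j) h p =
  if (j == ord0) && (h <= p) then nth None (cells A z) (p - h) else None.
Proof.
rewrite /content ffunE /=; case: ltnP => _; first by rewrite andbF nth_nil.
by rewrite andbT; case: eqP => // _; rewrite nth_nil.
Qed.

Lemma right_ok_step (f : bool) c h p z B :
  (f -> c = init M z /\ h = fun=> B) -> (halting c.1 -> output c = [:: true]) ->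
  right_ok (cell_of f c h p) (cell_of f c h p.+1).
Proof.
move=> hf hc; apply/and5P; split; rewrite ?eqxx //; last apply/andP; last split.
- by apply/forallP => j; rewrite !mark_cell_of mark_next_at.
- rewrite {1}/is_first /=; apply/implyP => /hf[-> ->].
  rewrite !mark_cell_of !sym_cell_of !init_content !eqxx /= /mark_at.
  case: (ltngtP p B) => //= Bp; rewrite ?(leqW (ltnW Bp)) ?nth_cells.
    by case: ltnP => //= zp; rewrite ifF //; lia.
  rewrite Bp leqnSn.
  by case: ltnP => //= z0; rewrite ifF //; lia.
- rewrite {1}/cstate /=; apply/implyP => /hc /leading_bits_true[h0 h1].
  rewrite !mark_cell_of !sym_cell_of; apply/implyP; rewrite /mark_at.
  case: (p =P h ord0) => // ->; rewrite content_head scanE h0 eqxx.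
  by rewrite /content ltnNge leqnSn subSnn.
Qed.

(** * Solutions of the grid are the accepting computations *)

Section Solutions.
Variables (T cols b k r : nat) (u : word).
Hypotheses (u_gt0 : 0 < size u) (Tb : T <= b) (bcols : b.+1 + T + 1 < cols).
Hypothesis ucols : b.+1 + size u + k < cols.
Hypothesis size_eq : b.+1 + size u + k + r.+2 = T.+1 * cols.

Let vok i := kind_ok (nth KAny (kinds b u k r) i).
Let conf w t := iter t (@step M) (init M (u ++ w)).

Fixpoint heads w t : I -> nat :=
  if t is t'.+1 then head_step (conf w t') (heads w t') else fun=> b.+1.

(** With [Tb] and [bcols], this keeps the heads strictly inside the row up to time [T], so no rule
    for the borders is needed. *)
Lemma heads_bound w t j : b.+1 <= heads w t j + t /\ heads w t j <= b.+1 + t.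
Proof.
elim: t => [|t [IH1 IH2]] /=; first by rewrite !addn0.
by rewrite /head_step; case: (next _ _).2 => _ [] /=; lia.
Qed.

Lemma grid_index t p : t <= T -> p < cols ->
  t * cols + p < T.+1 * cols /\
  ((t * cols + p) %/ cols = t /\ (t * cols + p) %% cols = p).
Proof.
move=> tT pc; split; last first.
  by rewrite divnMDl ?divn_small ?addn0 ?modnMDl ?modn_small //; lia.
by rewrite mulSn; apply: leq_trans (_ : t * cols + cols <= _);
  rewrite ?ltn_add2l // addnC leq_add2l leq_mul2r tT orbT.
Qed.

Lemma tableau_complete w : size w <= k -> halting (conf w T).1 ->
  output (conf w T) = [:: true] ->
  exists rho, grid_solution T.+1 cols vok right_ok down_ok rho.
Proof.
move=> wk hT outT.
have cols_gt0 : 0 < cols by lia.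
have row0 i : (i %/ cols == 0) = (i < cols).
  by rewrite eqn0Ngt divn_gt0 // -ltnNge.
pose rho i := cell_of (i %/ cols == 0) (conf w (i %/ cols)) (heads w (i %/ cols)) (i %% cols).
have row_lt i : i < T.+1 * cols -> i %/ cols <= T.
  by move=> iM; rewrite -ltnS ltn_divLR.
exists rho; split.
- move=> i iM; rewrite /vok /kind_ok /rho row0; set c := conf w _; set h := heads w _.
  have sym0 : i < cols -> sym (cell_of (i < cols) c h (i %% cols)) ord0 =
      if b.+1 <= i then nth None (cells A (u ++ w)) (i - b.+1) else None.
    move=> ic; rewrite sym_cell_of /c /h divn_small // modn_small //.
    by rewrite init_content eqxx.
  have markE j : i < cols -> mark (cell_of (i < cols) c h (i %% cols)) j =
      mark_at b.+1 i.
    by move=> ic; rewrite /mark /cell_of ffunE /= /h divn_small // modn_small.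
  apply/andP; split.
    apply/andP; split.
      apply/forallP => j; apply/implyP; rewrite mark_cell_of sym_cell_of.
      by rewrite /mark_at; case: (i %% cols =P h j) => // -> _; rewrite content_head /scanned ffunE.
    apply/implyP => ic; rewrite {1}/is_first /= in ic.
    apply/and4P; split.
    + by rewrite /cell_of /cstate /= /c divn_small.
    + apply/forallP => j; apply/implyP => j0; rewrite sym_cell_of /c.
      by rewrite divn_small // init_content (negPf j0).
    + by rewrite sym0 //; case: ifP => // _; rewrite nth_cells; case: ifP.
    + apply/implyP; rewrite markE // sym0 // /mark_at.
      by case: ltngtP => // ib _; rewrite leqNgt ib.
  rewrite nth_kinds; do 6?[case: ifP => //].
  + move=> /eqP ib _; have ic : i < cols by lia.
    apply/andP; split; first by [].
    apply/forallP => j; rewrite markE // ib /mark_at.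
    by rewrite ltn_eqF // ltnNge leqnSn.
  + move=> iu /eqP ib nib; have ic : i < cols by lia.
    have bi : b < i by lia.
    rewrite sym0 // bi nth_cells size_cat ifT; last by lia.
    rewrite nth_cat ifT ?eqxx /=; last by lia.
    apply/forallP => j; rewrite markE // /mark_at; case: (i =P b.+1) => // ib1.
    by have -> : b.+1 < i by lia.
  + move=> /eqP ik *; have ic : i < cols by lia.
    rewrite sym0 // ifT; last by lia.
    by rewrite nth_cells size_cat ifF //; lia.
  + move=> /eqP ir *; rewrite /cstate /= /c (_ : i %/ cols = T) //.
    (* By [size_eq], the final [KHalt] falls on the last cell of row [T]. *)
    have -> : i = T * cols + cols.-1.
      by have := size_eq; rewrite mulSn ir; lia.
    by have [] := @grid_index T cols.-1 (leqnn T) _; [lia | move=> _ []].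
- move=> i j jM /orP[/eqP ji|/andP[/eqP ji jc]].
    rewrite ji ifF; last by lia.
    have tT : (i %/ cols).+1 <= T.
      by have := row_lt j jM; rewrite ji divnDr ?dvdnn // divnn cols_gt0 addn1.
    rewrite /rho modnDr divnDr ?dvdnn // divnn cols_gt0 addn1 /=.
    by apply: down_ok_step => l; have := heads_bound w (i %/ cols) l; lia.
  have iM : i < T.+1 * cols by lia.
  rewrite ji eqxx /rho; rewrite ji in jc; have [-> ->] := link_right jc.
  apply: (@right_ok_step _ _ _ _ (u ++ w) b.+1) => [/eqP -> //|ht].
  (* A row that has halted already shows the configuration of time [T], whose output is known. *)
  rewrite -outT /conf -(subnK (row_lt i iM)) iterD.
  by rewrite [in RHS]iter_halting.
Qed.

(** Row 0 is forced up to the bits after [u], which are taken as the witness; the other rows follow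
    by [row_step]. *)
Lemma tableau_sound rho : grid_solution T.+1 cols vok right_ok down_ok rho ->
  exists w, [/\ size w <= k, halting (conf w T).1 & output (conf w T) = [:: true]].
Proof.
move=> [hv he]; have cols_gt0 : 0 < cols by lia.
pose row t p := rho (t * cols + p).
have hk t p : t <= T -> p < cols ->
    kind_ok (nth KAny (kinds b u k r) (t * cols + p)) (row t p).
  by move=> tT pc; have [iM _] := grid_index tT pc; exact: hv.
have hok t p : t <= T -> p < cols -> cell_ok (row t p).
  by move=> tT pc; have /andP[] := hk t p tT pc.
have hr t p : t <= T -> p.+1 < cols -> right_ok (row t p) (row t p.+1).
  move=> tT pc; have [iM [_ im]] := grid_index tT pc.
  have := he (t * cols + p) _ iM; rewrite /row addnS eqxx; apply.
  by rewrite /link eqxx -addnS im orbT.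
have hd t p : t < T -> p < cols -> down_ok (row t p) (row t.+1 p).
  move=> tT pc; have [iM _] := grid_index tT pc.
  have e : t.+1 * cols + p = t * cols + p + cols by rewrite mulSn; lia.
  have := he (t * cols + p) _ iM; rewrite ifF; last by rewrite e; lia.
  by rewrite /row; apply; rewrite /link e eqxx.
have hk0 p : p < cols -> kind_ok (nth KAny (kinds b u k r) p) (row 0 p).
  exact: (hk 0 p).
have [firstb markb] : is_first (row 0 b) /\ forall j, mark (row 0 b) j = Some false.
  have := hk0 b; rewrite nth_kinds ltnn eqxx => /(_ _)/andP[|_ /andP[]]; first lia.
  by move=> -> /forallP h; split=> // j; exact/eqP.
have bits q : q < size u -> sym (row 0 (b.+1 + q)) ord0 = Some (inl (nth false u q))
    /\ forall j, mark (row 0 (b.+1 + q)) j != Some false.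
  move=> qu; have := hk0 (b.+1 + q); rewrite nth_kinds ifF; last by lia.
  rewrite ifF; last by lia.
  rewrite ifT; last by lia.
  rewrite addKn => /(_ _)/andP[|_ /andP[/eqP -> /forallP h]]; first by lia.
  by split.
have blank : sym (row 0 (b.+1 + size u + k)) ord0 = None.
  have := hk0 (b.+1 + size u + k) ucols; rewrite nth_kinds.
  do 4![rewrite ifF; last by lia].
  by rewrite eqxx => /andP[_ /eqP].
have marks0 j p : p < cols -> mark (row 0 p) j = mark_at b.+1 p.
  move: p; apply: marks_unique.
  - by move=> p /(hr 0 p isT)/and5P[_ _ _ /forallP].
  - lia.
  - have := hr 0 b isT; have -> : (b.+1 < cols) by lia.
    move=> /(_ isT)/and5P[_ _ _ /forallP/(_ j)]; rewrite markb.
    have [_ /(_ j)] := bits 0 u_gt0; rewrite addn0.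
    by case: (mark _ j) => [[]|].
have hr0 := fun p => hr 0 p isT.
have first0 p : p < cols -> is_first (row 0 p).
  by move=> pc; have [||-> _ _] := @row_const cols (row 0) hr0 p b; lia.
pose n := b.+1 + size u.
(* Column [n] is the first one after [u]; [L] is the input tape from there to the end of the row. *)
pose L := mkseq (fun q => sym (row 0 (n + q)) ord0) (cols - n).
have nthL q : nth None L q =
    if q < cols - n then sym (row 0 (n + q)) ord0 else None.
  case: ltnP => [qc|cq]; first by rewrite nth_mkseq.
  by rewrite nth_default ?size_mkseq.
have first_ok p : p < cols -> [&& cstate (row 0 p) == @start M,
    [forall j, (j != ord0) ==> (sym (row 0 p) j == None)],
    is_bit (sym (row 0 p) ord0) || (sym (row 0 p) ord0 == None)
    & (mark (row 0 p) ord0 == Some false) ==> (sym (row 0 p) ord0 == None)].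
  by move=> pc; have /andP[_ /implyP h] := hok 0 p isT pc; exact/h/first0.
have Lbit q : is_bit (nth None L q) || (nth None L q == None).
  rewrite nthL; case: ifP => // qc; have pc : n + q < cols by lia.
  by have /and4P[] := first_ok _ pc.
have Lblank q : nth None L q = None -> nth None L q.+1 = None.
  rewrite !nthL; case: (ltnP q.+1) => // qc; rewrite ltnW // => Lq.
  have pc : (n + q).+1 < cols by lia.
  have /and5P[_ _ _ _ /andP[h _]] := hr0 _ pc; move: h.
  rewrite first0 ?(ltnW pc) // marks0 ?(ltnW pc) // Lq eqxx /mark_at -addnS.
  case: (n + q =P b.+1) => /= _; first by move=> /eqP.
  by have -> : b.+1 < n + q; [rewrite /n; lia | move=> /= /eqP].
pose w := leading_bits L; have Lw := nth_leading_bits Lbit Lblank.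
have row0E p : p < cols -> row 0 p = cell_of true (init M (u ++ w)) (fun=> b.+1) p.
  have symE q j : q < cols -> sym (row 0 q) j = content ((init M (u ++ w)).2 j) b.+1 q.
    move=> qc; have /and4P[_ /forallP/(_ j) hj _ hl] := first_ok q qc.
    rewrite init_content; case: eqP hj => [-> _|/eqP j0 /eqP //] /=.
    move: hl; rewrite marks0 // /mark_at; have [qb|bq] /= := ltnP q b.+1.
      by rewrite ltn_eqF // ltnNge (ltnW qb) /= => /eqP.
    move=> _; rewrite nth_cells size_cat nth_cat.
    have [qu|uq] := ltnP (q - b.+1) (size u).
      have [] := bits _ qu; rewrite subnKC // => -> _.
      by rewrite ifT // ltn_addr.
    rewrite -ltn_subLR // -nth_cells -Lw nthL ifT; last by rewrite /n; lia.
    by congr (sym (row 0 _) _); rewrite /n; lia.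
  move=> pc; apply: tcell_ext.
  - exact: first0.
  - by have /and4P[/eqP] := first_ok p pc.
  - apply/ffunP => j; have b1 : b.+1 < cols by lia.
    have [_ _ ->] := row_const hr0 pc b1.
    have /andP[/forallP /(_ j) /implyP ok _] := hok 0 b.+1 isT b1.
    by rewrite -(eqP (ok _)) ?marks0 ?/mark_at ?eqxx // symE // content_head [RHS]ffunE.
  - by move=> j; rewrite symE // sym_cell_of.
  - by move=> j; rewrite marks0 // mark_cell_of.
have rowE t p : t <= T -> p < cols ->
    row t p = cell_of (t == 0) (conf w t) (heads w t) p.
  elim: t p => [|t IHt] p tT pc; first exact: row0E.
  apply: (@row_step cols (row t) (row t.+1) (t == 0) (conf w t) (heads w t)) => //.
  - by move=> q qc; apply: IHt => //; exact: ltnW.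
  - by move=> q qc; exact: hd.
  - by move=> q qc; exact: hr.
  - by move=> q qc; exact: hok.
  - by move=> j; have := heads_bound w t j; lia.
have hT : halting (conf w T).1.
  have lc : cols.-1 < cols by lia.
  have := hk T cols.-1 (leqnn _) lc; rewrite rowE // nth_kinds.
  have e : T * cols + cols.-1 = b.+1 + size u + k + r.+1.
    by have := size_eq; rewrite mulSn; lia.
  rewrite e; do 5![rewrite ifF; last by lia].
  by rewrite eqxx => /andP[].
exists w; split=> //.
(* A longer witness would put a bit on the [KBlank] cell, at offset [k] in [L]. *)
- rewrite leqNgt; apply/negP => kw; have := Lw k.
  by rewrite nthL nth_cells kw ifT ?blank // /n; lia.
- pose p := heads w T ord0; have := heads_bound w T ord0; rewrite -/p => hp.
  have pc : p.+1 < cols by lia.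
  have /and5P[_ _ _ _ /andP[_]] := hr T p (leqnn _) pc.
  rewrite !rowE ?(ltnW pc) // {1}/cstate /= hT.
  rewrite mark_cell_of !sym_cell_of {1}/mark_at eqxx /= => /andP[/eqP h0 h1].
  apply/leading_bits_true; rewrite -scanE -(content_head _ p) h0; split=> //.
  by move: h1; rewrite /content ltnNge leqnSn subSnn.
Qed.

End Solutions.
End Tableau.

(** * Generating the encoding of a grid instance *)

Lemma rev_iota0 m : rev (iota 0 m.+1) = m :: rev (iota 0 m).
Proof. by rewrite -[m.+1]addn1 iotaD rev_cat. Qed.

Lemma rev_iotaE m : rev (iota 0 m) = [seq m - t.+1 | t <- iota 0 m].
Proof.
apply: (@eq_from_nth _ 0) => [|i]; first by rewrite size_rev size_map.
rewrite size_rev size_iota => im.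
rewrite nth_rev ?size_iota // (nth_map 0) ?size_iota // !nth_iota //; lia.
Qed.

(** The word that remains to be read is a unary counter running from [m - 1] down to 0. *)
Lemma loop_nseq F m :
  loop F (nseq m true) = flatten [seq F (nseq v true) true | v <- rev (iota 0 m)].
Proof. by elim: m => // m IHm; rewrite rev_iota0 /= IHm. Qed.

Lemma sem_For l env g a m : sem l.+1 env g = nseq m true ->
  sem l env (For g a a) =
  flatten [seq sem l.+1 (upd env l (nseq v true)) a | v <- rev (iota 0 m)].
Proof. by move=> E; rewrite /= E rev_nseq loop_nseq. Qed.

Definition repeat (g : gen) (w : word) : gen := For g (Emit w) (Emit w).

Lemma sem_repeat l env g w m : sem l.+1 env g = nseq m true ->
  sem l env (repeat g w) = flatten (nseq m w).
Proof.
move=> /sem_For ->; congr flatten => /=.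
by elim: m => // m IHm; rewrite rev_iota0 /= IHm.
Qed.

Lemma flatten_nseq1 (T : Type) m (a : T) : flatten (nseq m [:: a]) = nseq m a.
Proof. by elim: m => //= m ->. Qed.

Definition closed (g : gen) : Prop :=
  forall vs l, 0 \in vs -> 0 < l -> scoped vs l g.

(* g computes f n in unary, where n is the size of the input (variable 0). *)
Definition numeral (g : gen) (f : nat -> nat) : Prop := closed g /\
  forall l env, 0 < l -> sem l env g = nseq (f (size (env 0))) true.

Definition gconst m := Emit (nseq m true).
Definition gsize := For (Copy 0) (Emit [:: true]) (Emit [:: true]).
Definition gmul g g' := For g g' g'.
Fixpoint gpow g m := if m is m'.+1 then gmul g (gpow g m') else gconst 1.

Lemma numeral_const m : numeral (gconst m) (fun=> m).
Proof. by []. Qed.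

Lemma numeral_size : numeral gsize id.
Proof.
split=> [vs l v0 l0|l env l0]; first by rewrite /= v0.
rewrite /= -(size_rev (env 0)); elim: (rev _) => //= b s ->.
by rewrite if_same.
Qed.

Lemma numeralD g g' f f' : numeral g f -> numeral g' f' ->
  numeral (Cat g g') (fun n => f n + f' n).
Proof.
move=> [cg hg] [cg' hg']; split=> [vs l v0 l0|l env l0] /=.
  by rewrite cg ?cg'.
by rewrite hg ?hg' // nseqD.
Qed.

(** Here [g] need not be a numeral: it will be a loop counter, which does not depend on the input
    size alone. *)
Lemma sem_gmul l env g g' f' a : 0 < l -> sem l.+1 env g = nseq a true ->
  numeral g' f' -> sem l env (gmul g g') = nseq (a * f' (size (env 0))) true.
Proof.
move=> l0 E [_ hg']; rewrite (sem_For _ E); elim: a {E} => // a IHa.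
by rewrite rev_iota0 /= IHa hg' // /upd ltn_eqF // mulSn nseqD.
Qed.

Lemma sem_Cat l env g g' : sem l env (Cat g g') = sem l env g ++ sem l env g'.
Proof. by []. Qed.

Lemma scoped_Cat vs l g g' : scoped vs l g -> scoped vs l g' -> scoped vs l (Cat g g').
Proof. by move=> /= -> ->. Qed.

Lemma scoped_For vs l g g' :
  scoped vs l.+1 g -> scoped (l :: vs) l.+1 g' -> scoped vs l (For g g' g').
Proof. by move=> /= -> ->. Qed.

Lemma scoped_repeat vs l g w : scoped vs l.+1 g -> scoped vs l (repeat g w).
Proof. by move=> sg; apply: scoped_For. Qed.

Lemma numeralM g g' f f' : numeral g f -> numeral g' f' ->
  numeral (gmul g g') (fun n => f n * f' n).
Proof.
move=> [cg hg] ng'; split=> [vs l v0 l0|l env l0].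
  by apply: scoped_For; [exact: cg | apply: ng'.1; rewrite ?inE ?v0 ?orbT].
exact: sem_gmul (hg _ _ _) ng'.
Qed.

Lemma numeralX g f m : numeral g f -> numeral (gpow g m) (fun n => f n ^ m).
Proof.
move=> hg; elim: m => [|m IHm]; first exact: numeral_const.
have [cg h] := numeralM hg IHm; split=> // l env l0.
by rewrite h // expnS.
Qed.

Lemma big_cat_flatten (I : Type) (s : seq I) (f : I -> word) :
  \big[cat/[::]]_(i <- s) f i = flatten (map f s).
Proof. by elim: s => [|i s IHs]; rewrite ?big_nil ?big_cons //= IHs. Qed.

Lemma big_cat_ord n (f : nat -> word) :
  \big[cat/[::]]_(i < n) f i = flatten [seq f i | i <- iota 0 n].
Proof. by rewrite -(big_mkord xpredT) big_cat_flatten /index_iota subn0. Qed.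

Lemma big_cat_ord_gt n i (f : nat -> word) : i < n ->
  \big[cat/[::]]_(j < n | i < j) f j = flatten [seq f j | j <- iota i.+1 (n - i.+1)].
Proof.
move=> ni; rewrite -(big_mkord (fun j => i < j)) -big_filter big_cat_flatten.
congr (flatten (map f _)); rewrite /index_iota subn0.
rewrite -{1}(subnKC ni) iotaD filter_cat.
rewrite (@eq_in_filter _ _ pred0) ?filter_pred0 ?cat0s; last first.
  by move=> j; rewrite mem_iota /= add0n ltnS leqNgt => /negbTE.
by apply/all_filterP/allP => j; rewrite mem_iota => /andP[].
Qed.

Lemma flatten_iotaM (m n : nat) (f : nat -> word) :
  flatten [seq f i | i <- iota 0 (m * n)] =
  flatten [seq flatten [seq f (t * n + p) | p <- iota 0 n] | t <- iota 0 m].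
Proof.
elim: m => // m IHm; rewrite -[m.+1]addn1 mulnDl mul1n !iotaD !map_cat !flatten_cat IHm.
congr (_ ++ _); rewrite /= cats0 add0n.
by rewrite -[X in iota X](addn0 (m * n)) iotaDl -map_comp.
Qed.

Lemma flatten_map_nseq (I : eqType) (s : seq I) (f : I -> word) b :
  {in s, forall i, f i = [:: b]} -> flatten (map f s) = nseq (size s) b.
Proof.
elim: s => //= i s IHs h; rewrite h ?mem_head // IHs // => j js.
by rewrite h // inE js orbT.
Qed.

(** * The list of edges of a grid, with its runs of absent pairs *)

Section Edges.
Variables (T n : nat) (right_word down_word : word).
Let cols := n.+2.
Let size_grid := T.+1 * cols.

Definition edge_word (i j : nat) : word :=
  if link cols i j then (if j == i.+1 then right_word else down_word)
  else [:: false].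

Let tail i := flatten [seq edge_word i j | j <- iota i.+1 (size_grid - i.+1)].

Lemma edge_zeros i a m : (forall j, a <= j < a + m -> ~~ link cols i j) ->
  flatten [seq edge_word i j | j <- iota a m] = nseq m false.
Proof.
move=> h; rewrite (@flatten_map_nseq _ _ _ false) ?size_iota // => j.
by rewrite mem_iota /edge_word => /h/negbTE ->.
Qed.

Lemma size_gridE t : t < T ->
  size_grid = t * cols + cols + ((T - t.+1) * cols + cols).
Proof. by move=> tT; rewrite -!mulSnr -mulnDl; congr (_ * _); lia. Qed.

Lemma edge_single i a :
  flatten [seq edge_word i j | j <- iota a 1] = edge_word i a.
Proof. by rewrite /= cats0. Qed.

(** The right neighbour is at distance 1 and the lower one at distance [n + 2], so [n] absent pairs
    lie between them; all later pairs are absent. *)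
Lemma tail_inner t p : t < T -> p < n.+1 -> tail (t * cols + p) =
  right_word ++ nseq n false ++ down_word ++
  nseq ((T - t.+1) * cols + (n.+1 - p.+1).+1) false.
Proof.
move=> tT pn; rewrite /tail; set i := t * cols + p.
set m := (T - t.+1) * cols + (n.+1 - p.+1).+1.
have -> : size_grid - i.+1 = 1 + (n + (1 + m)).
  rewrite (size_gridE tT) /i /m; set X := (T - t.+1) * cols; set Y := t * cols.
  by rewrite /cols; lia.
have im : i.+1 %% cols = p.+1 by rewrite /i -addnS modnMDl modn_small.
rewrite 3!iotaD !map_cat !flatten_cat !edge_single.
rewrite {1}/edge_word {1}/link eqxx im orbT.
rewrite edge_zeros; last by move=> j; rewrite /link /cols; lia.
rewrite {1}/edge_word {1}/link (_ : (i.+1 + 1 + n == i + cols)); last by rewrite /cols; lia.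
rewrite ifF; last by lia.
by rewrite edge_zeros // => j; rewrite /link /cols; lia.
Qed.

Lemma tail_last_col t : t < T -> tail (t * cols + n.+1) =
  nseq n.+1 false ++ down_word ++ nseq ((T - t.+1) * cols) false.
Proof.
move=> tT; rewrite /tail; set i := t * cols + n.+1; set m := (T - t.+1) * cols.
have -> : size_grid - i.+1 = n.+1 + (1 + m).
  by rewrite (size_gridE tT) /i -/m; set Y := t * cols; rewrite /cols; lia.
have im : i.+1 %% cols = 0 by rewrite /i -addnS -/cols modnMDl modnn.
rewrite 2!iotaD !map_cat !flatten_cat edge_single.
rewrite edge_zeros; last first.
  move=> j hj; rewrite /link; case: (j =P i.+1) => [->|ji]; last by rewrite /cols; lia.
  by rewrite im /cols; lia.
rewrite {1}/edge_word {1}/link (_ : (i.+1 + n.+1 == i + cols)); last by rewrite /cols; lia.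
rewrite ifF; last by lia.
by rewrite edge_zeros // => j; rewrite /link /cols; lia.
Qed.

Lemma tail_last_row p : p < n.+1 -> tail (T * cols + p) =
  right_word ++ nseq (n.+1 - p.+1) false.
Proof.
move=> pn; rewrite /tail; set i := T * cols + p; set m := n.+1 - p.+1.
have -> : size_grid - i.+1 = 1 + m.
  by rewrite /size_grid /i mulSn /m; set Y := T * cols; rewrite /cols; lia.
have im : i.+1 %% cols = p.+1 by rewrite /i -addnS modnMDl modn_small.
rewrite iotaD !map_cat !flatten_cat edge_single.
rewrite {1}/edge_word {1}/link eqxx im orbT.
by rewrite edge_zeros // => j; rewrite /m /link /cols; lia.
Qed.

Lemma tail_last : tail (T * cols + n.+1) = [::].
Proof.
rewrite /tail (_ : size_grid - _ = 0) // /size_grid mulSn.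
by set Y := T * cols; rewrite /cols; lia.
Qed.

(** Loop counters run down, so [r] stands for [T - t.+1] and [c] for [n.+1 - p.+1]; in these terms
    the lengths of the runs need no subtraction. *)
Definition edges_word : word :=
  flatten [seq flatten [seq right_word ++ nseq n false ++ down_word ++
                          nseq (r * cols + c.+1) false | c <- rev (iota 0 n.+1)]
             ++ nseq n.+1 false ++ down_word ++ nseq (r * cols) false
          | r <- rev (iota 0 T)]
  ++ flatten [seq right_word ++ nseq c false | c <- rev (iota 0 n.+1)].

Lemma row_split (f : nat -> word) : flatten [seq f p | p <- iota 0 cols] =
  flatten [seq f p | p <- iota 0 n.+1] ++ f n.+1.
Proof.
by rewrite (_ : cols = n.+1 + 1) ?addn1 // -addn1 iotaD map_cat flatten_cat /= cats0.
Qed.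

Lemma flatten_tails : flatten [seq tail i | i <- iota 0 size_grid] = edges_word.
Proof.
rewrite flatten_iotaM -[T.+1]addn1 iotaD map_cat flatten_cat /= cats0 add0n.
congr (_ ++ _).
- rewrite (rev_iotaE T) -map_comp; congr flatten; apply/eq_in_map => t.
  rewrite mem_iota add0n => /andP[_ tT]; apply: etrans (row_split _) _.
  rewrite tail_last_col //; congr (_ ++ _); rewrite rev_iotaE -map_comp.
  congr flatten; apply/eq_in_map => p; rewrite mem_iota add0n => /andP[_ pn].
  by rewrite tail_inner.
- apply: etrans (row_split _) _; rewrite tail_last cats0 rev_iotaE -map_comp.
  congr flatten; apply/eq_in_map => p; rewrite mem_iota add0n => /andP[_ pn].
  by rewrite tail_last_row.
Qed.

End Edges.

(** The size half of [exec_compile], for an arbitrary choice of tapes; it bounds the size of the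
    generated instance. *)
Lemma size_sem g x : scoped [:: 0] 1 g -> size (sem 1 (fun=> x) g) <= cost g (size x).
Proof.
move=> sg; pose K := (depth 1 g).+1.
have [] := @exec_compile K 1 void g [:: 0] 1 0 (fun=> x) (upd (fun=> [::]) 1 x)
  (size x) sg.
- by rewrite /K; lia.
- by [].
- by [].
- by move=> v; rewrite inE => /eqP ->.
- by move=> j j0; rewrite /upd ifN //; lia.
- by [].
Qed.

Lemma runs_in_le M x t t' y : t <= t' -> runs_in M x t y -> runs_in M x t' y.
Proof.
rewrite /runs_in /=; move=> tt' [ht <-]; rewrite -(subnK tt') iterD.
by rewrite iter_halting.
Qed.

Lemma size_delimit x : size (delimit x) = size x * 2 + 1.
Proof.
rewrite /delimit size_cat; congr (_ + _); elim: x => //= b x ->.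
by rewrite mulSn.
Qed.

(** The unary code of 0 starts with [false] and all others with [true], so the first output bit
    tells whether vertex 0 gives up. *)
Lemma head_enc_unary n (s : 'I_n -> nat) (i0 : 'I_n) : i0 = 0 :> nat ->
  head false (\big[cat/[::]]_(i < n) enc_unary (s i)) = (s i0 != 0).
Proof.
case: n s i0 => [|n] s i0 i00; first by case: i0 i00.
rewrite big_ord_recl (_ : i0 = ord0); last exact: val_inj.
by case: (s ord0).
Qed.

(** * The reduction *)

Section Reduction.
Variables (M : machine) (c d : nat).
Let D := tcell M.

Definition wit n := n ^ c + c.
Definition time0 n := (n * 2 + 1 + wit n) ^ d + d.
(** The verifier needs [time0 n] steps; the successor makes the number [nrest] of remaining cells a
    sum, without subtraction. *)
Definition time n := (time0 n).+1.
Definition inner n := time n + (n * 2 + 1) + wit n + 1 + time n.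
Definition ncols n := (inner n).+2.
Definition nrest n := time0 n + time n * ncols n.

Lemma ncells_eq x : (time (size x)).+2 + size (delimit x) + wit (size x) +
  (nrest (size x)).+2 = (time (size x)).+1 * ncols (size x).
Proof.
rewrite size_delimit mulSn /nrest; set X := time (size x) * ncols (size x).
by rewrite /ncols /inner /time; lia.
Qed.

(** The left margin has one cell more than [time]: vertex 0, the only one charged for giving up, is
    split off when the list is generated. *)
Definition vertex_kinds (x : word) : seq kind :=
  kinds (time (size x)).+1 (delimit x) (wit (size x)) (nrest (size x)).

Definition vertex_pred (x : word) (i : nat) : pred D :=
  @kind_ok M (nth KAny (vertex_kinds x) i).

Definition reduce (x : word) : instance :=
  @grid_instance (time (size x)).+1 (ncols (size x)) D
    (vertex_pred x) (@right_ok M) (@down_ok M).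

Definition vertex_word (first : bool) (k : kind) : word :=
  \big[cat/[::]]_(a < #|D|.+1)
    enc_ereal (vertex_cost (if first then 1 else 0)%E (@kind_ok M k) a).

Definition edge_table (r : rel D) : word :=
  true :: (\big[cat/[::]]_(a < #|D|.+1) \big[cat/[::]]_(b < #|D|.+1)
    enc_ereal (edge_cost r a b)) ++ enc_rat (2%:R^-1)%R ++ enc_rat (2%:R^-1)%R.

Let right_word := edge_table (@right_ok M).
Let down_word := edge_table (@down_ok M).

Lemma flatten_first_kind (F : bool -> kind -> word) k ks :
  flatten [seq F (i == 0) (nth KAny (k :: ks) i) | i <- iota 0 (size (k :: ks))] =
  F true k ++ flatten (map (F false) ks).
Proof.
rewrite /= -[1]addn0 iotaDl -map_comp; congr (_ ++ flatten _).
by rewrite -[in RHS](mkseq_nth KAny ks) /mkseq -map_comp.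
Qed.

Lemma enc_reduce x : enc_instance (reduce x) =
  enc_unary #|D|.+1 ++ enc_unary ((time (size x)).+1 * ncols (size x)) ++
  flatten [seq vertex_word (i == 0) (nth KAny (vertex_kinds x) i)
          | i <- iota 0 (size (vertex_kinds x))] ++
  edges_word (time (size x)) (inner (size x)) right_word down_word.
Proof.
have sz : size (vertex_kinds x) = (time (size x)).+1 * ncols (size x).
  by rewrite size_kinds ncells_eq.
rewrite /enc_instance; congr (_ ++ (_ ++ (_ ++ _))).
  by rewrite sz -big_cat_ord.
rewrite -flatten_tails -/(ncols (size x)) -big_cat_ord; apply: eq_bigr => i _.
rewrite -big_cat_ord_gt //; apply: eq_bigr => j ij.
rewrite /enc_edge /= /grid_adj ij /edge_word -/(ncols (size x)).
have -> : link (ncols (size x)) j i = false.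
  apply/negbTE/negP => /(@link_lt (ncols (size x)) _ _ isT) ji.
  by have := ltn_trans ij ji; rewrite ltnn.
by rewrite orbF; case: ifP => // _; case: ifP => _.
Qed.

Definition gwit := Cat (gpow gsize c) (gconst c).
Definition gtime0 :=
  Cat (gpow (Cat (Cat (gmul gsize (gconst 2)) (gconst 1)) gwit) d) (gconst d).
Definition gtime := Cat gtime0 (gconst 1).
Definition ginner := Cat (Cat (Cat (Cat gtime
  (Cat (gmul gsize (gconst 2)) (gconst 1))) gwit) (gconst 1)) gtime.
Definition gncols := Cat ginner (gconst 2).
Definition gnrest := Cat gtime0 (gmul gtime gncols).

Lemma numeral_wit : numeral gwit wit.
Proof. exact: numeralD (numeralX _ numeral_size) (numeral_const _). Qed.

Lemma numeral_time0 : numeral gtime0 time0.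
Proof.
apply: numeralD (numeralX _ _) (numeral_const _).
apply: numeralD (numeralD _ (numeral_const _)) numeral_wit.
exact: numeralM numeral_size (numeral_const _).
Qed.

Lemma numeral_ext g f f' : f =1 f' -> numeral g f -> numeral g f'.
Proof. by move=> e [cg h]; split=> // l env l0; rewrite h // e. Qed.

Lemma numeral_time : numeral gtime time.
Proof.
apply: numeral_ext (numeralD numeral_time0 (numeral_const 1)) => n.
by rewrite addn1.
Qed.

Lemma numeral_inner : numeral ginner inner.
Proof.
apply: numeralD numeral_time; apply: numeralD (numeral_const _).
apply: numeralD numeral_wit; apply: (numeralD numeral_time).
apply: numeralD (numeral_const _).
exact: numeralM numeral_size (numeral_const _).
Qed.

Lemma numeral_ncols : numeral gncols ncols.
Proof.
apply: numeral_ext (numeralD numeral_inner (numeral_const 2)) => n.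
by rewrite addn2.
Qed.

Lemma numeral_nrest : numeral gnrest nrest.
Proof. exact: numeralD numeral_time0 (numeralM numeral_time numeral_ncols). Qed.

(** Loops read backwards, so the inner one reverses the input beforehand. Each bit [b] yields the
    two cells [true], [b] of the delimited input. *)
Definition ginput : gen :=
  For (For (Copy 0) (Emit [:: true]) (Emit [:: false]))
    (Emit (vertex_word false (KBit true) ++ vertex_word false (KBit true)))
    (Emit (vertex_word false (KBit true) ++ vertex_word false (KBit false))).

Definition gvertices : gen :=
  Cat (Emit (vertex_word true KAny))
  (Cat (repeat gtime (vertex_word false KAny))
  (Cat (Emit (vertex_word false KLeft))
  (Cat ginput
  (Cat (Emit (vertex_word false (KBit false)))
  (Cat (repeat gwit (vertex_word false KAny))
  (Cat (Emit (vertex_word false KBlank))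
  (Cat (repeat gnrest (vertex_word false KAny))
  (Emit (vertex_word false KHalt))))))))).

Definition gdup g g' := For g g' g'.

(** Generated at level 1: in the first part variable 1 counts rows and variable 2 columns; in the
    final loop variable 1 counts the columns of the last row. *)
Definition gedges : gen :=
  Cat (gdup gtime
    (Cat (gdup (Cat ginner (gconst 1))
       (Cat (Emit right_word) (Cat (repeat ginner [:: false])
         (Cat (Emit down_word)
           (repeat (Cat (gmul (Copy 1) gncols) (Cat (Copy 2) (gconst 1))) [:: false])))))
    (Cat (repeat (Cat ginner (gconst 1)) [:: false]) (Cat (Emit down_word)
       (repeat (gmul (Copy 1) gncols) [:: false])))))
  (gdup (Cat ginner (gconst 1)) (Cat (Emit right_word) (repeat (Copy 1) [:: false]))).

Definition greduce : gen :=
  Cat (Emit (enc_rat 1 ++ enc_unary #|D|.+1))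
  (Cat (gmul (Cat gtime (gconst 1)) gncols) (Cat (Emit [:: false])
  (Cat gvertices gedges))).

Lemma loop_map (F : bool -> word) s : loop (fun _ b => F b) s = flatten (map F s).
Proof. by elim: s => //= b s ->. Qed.

Lemma sem_input env l : 0 < l -> sem l env ginput =
  flatten [seq vertex_word false (KBit true) ++ vertex_word false (KBit b) | b <- env 0].
Proof.
move=> l0; rewrite /ginput /=.
have -> : loop (fun (_ : word) (b : bool) => if b then [:: true] else [:: false])
    (rev (env 0)) = rev (env 0).
  by elim: (rev _) => //= b s ->; case: b.
rewrite revK -(loop_map (fun b => vertex_word false (KBit true) ++
  vertex_word false (KBit b))).
by elim: (env 0) => //= b s ->; case: b.
Qed.

Lemma flatten_kinds (F : kind -> word) b u k r :
  flatten (map F (kinds b u k r)) =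
  flatten (nseq b (F KAny)) ++ F KLeft ++ flatten [seq F (KBit a) | a <- u] ++
  flatten (nseq k (F KAny)) ++ F KBlank ++ flatten (nseq r (F KAny)) ++ F KHalt.
Proof.
rewrite /kinds map_cat flatten_cat map_nseq /= map_cat flatten_cat -map_comp.
rewrite map_cat flatten_cat map_nseq /= map_cat flatten_cat map_nseq /= cats0.
by [].
Qed.

Lemma flatten_delimit (F : bool -> word) x :
  flatten (map F (delimit x)) = flatten [seq F true ++ F b | b <- x] ++ F false.
Proof.
by elim: x => [|b x IHx] /=; [rewrite cats0 | rewrite -/(delimit x) IHx !catA].
Qed.

Lemma sem_vertices x l env : 0 < l -> env 0 = x -> sem l env gvertices =
  flatten [seq vertex_word (i == 0) (nth KAny (vertex_kinds x) i)
          | i <- iota 0 (size (vertex_kinds x))].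
Proof.
move=> l0 ex; rewrite /vertex_kinds.
have -> b u k r : kinds b.+1 u k r = KAny :: kinds b u k r by [].
rewrite flatten_first_kind flatten_kinds flatten_delimit.
have rep g f w : numeral g f -> sem l env (repeat g w) = flatten (nseq (f (size x)) w).
  by move=> [_ h]; apply: sem_repeat; rewrite h // ex.
rewrite -[sem l env gvertices]/(vertex_word true KAny ++
  sem l env (repeat gtime _) ++ vertex_word false KLeft ++ sem l env ginput ++
  vertex_word false (KBit false) ++ sem l env (repeat gwit _) ++
  vertex_word false KBlank ++ sem l env (repeat gnrest _) ++ vertex_word false KHalt).
rewrite (rep _ _ _ numeral_time) (rep _ _ _ numeral_wit) (rep _ _ _ numeral_nrest).
by rewrite sem_input // ex !catA.
Qed.

Lemma sem_edges x env : env 0 = x -> sem 1 env gedges =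
  edges_word (time (size x)) (inner (size x)) right_word down_word.
Proof.
move=> ex.
have n1 : numeral (Cat ginner (gconst 1)) (fun n => (inner n).+1).
  by apply: numeral_ext (numeralD numeral_inner (numeral_const 1)) => n; rewrite addn1.
have num g f l' env' : numeral g f -> 0 < l' -> env' 0 = x ->
    sem l' env' g = nseq (f (size x)) true.
  by move=> [_ h] l'0 e; rewrite h // e.
have ng1 := num _ _ _ _ n1; have ngi := num _ _ _ _ numeral_inner.
have cell r l' env' : 0 < l' -> env' 0 = x -> env' 1 = nseq r true ->
    sem l' env' (gmul (Copy 1) gncols) = nseq (r * ncols (size x)) true.
  by move=> l'0 e0 e1; rewrite (sem_gmul (g := Copy 1) (env := env') l'0 e1 numeral_ncols) e0.
rewrite /gedges /gdup sem_Cat /edges_word; congr (_ ++ _).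
  rewrite (sem_For _ (num _ _ 2 env numeral_time isT ex)).
  congr flatten; apply: eq_map => r; set e1 := upd env 1 _.
  have e10 : e1 0 = x by [].
  rewrite sem_Cat; congr (_ ++ _).
    rewrite (sem_For _ (ng1 3 e1 isT e10)).
    congr flatten; apply: eq_map => q; set e2 := upd e1 2 _.
    have e20 : e2 0 = x by [].
    rewrite 3!sem_Cat (sem_repeat _ (ngi 4 e2 isT e20)) flatten_nseq1.
    rewrite (@sem_repeat _ _ _ _ (r * ncols (size x) + q.+1)) ?flatten_nseq1 //.
    by rewrite 2!sem_Cat (cell r) // nseqD -[q.+1]addn1 nseqD.
  rewrite 2!sem_Cat (sem_repeat _ (ng1 3 e1 isT e10)) flatten_nseq1.
  by rewrite (sem_repeat _ (cell r 3 e1 isT e10 erefl)) flatten_nseq1.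
rewrite (sem_For _ (ng1 2 env isT ex)); congr flatten; apply: eq_map => q.
by rewrite sem_Cat (@sem_repeat _ _ _ _ q) // flatten_nseq1.
Qed.

Lemma scoped_greduce : scoped [:: 0] 1 greduce.
Proof.
have num g f vs l : numeral g f -> 0 \in vs -> 0 < l -> scoped vs l g.
  by move=> [h _] ? ?; exact: h.
have rep g f vs l w : numeral g f -> 0 \in vs -> scoped vs l (repeat g w).
  by move=> ng v0; apply: scoped_repeat; exact: num ng v0 _.
have n1 := numeralD numeral_inner (numeral_const 1).
have cell vs l w : 0 \in vs -> 1 \in vs ->
    scoped vs l (repeat (gmul (Copy 1) gncols) w).
  move=> v0 v1; apply/scoped_repeat/scoped_For => //.
  by apply: num numeral_ncols _ _ => //; rewrite inE v0 orbT.
apply: scoped_Cat => //; apply: scoped_Cat.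
  by apply: num (numeralM (numeralD numeral_time (numeral_const 1)) numeral_ncols) _ _.
apply: scoped_Cat => //; apply: scoped_Cat.
  by do !apply: scoped_Cat => //; [apply: rep numeral_time _ | apply: rep numeral_wit _
    | apply: rep numeral_nrest _].
apply: scoped_Cat.
  apply: scoped_For; first exact: num numeral_time _ _.
  apply: scoped_Cat.
    apply: scoped_For; first exact: num n1 _ _.
    do !apply: scoped_Cat => //; first exact: rep numeral_inner _.
    apply: scoped_repeat; apply: scoped_Cat => //.
    by apply: scoped_For => //; apply: num numeral_ncols _ _.
  apply: scoped_Cat; first exact: rep n1 _.
  by apply: scoped_Cat => //; exact: cell.
apply: scoped_For; first exact: num n1 _ _.
by [].
Qed.

Lemma sem_greduce x :
  sem 1 (fun=> x) greduce = enc_rat 1 ++ enc_instance (reduce x).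
Proof.
rewrite enc_reduce /greduce 4!sem_Cat (sem_edges (x := x)) // (sem_vertices (x := x)) //.
have [_ ->] := numeralM (numeralD numeral_time (numeral_const 1)) numeral_ncols => //.
rewrite /enc_unary addn1 -!catA; congr (_ ++ (_ ++ _)).
Qed.

Lemma reduce_valid (R : realType) x : valid_instance R (reduce x).
Proof. by apply: grid_valid. Qed.

Section Correct.
Variable V : language.
Hypothesis decides : forall z, exists2 y,
  runs_in M z (size z ^ d + d) y & (V z <-> y = [:: true]).

Lemma reduceP x : (exists2 w, size w <= wit (size x) & V (pair_word x w)) <->
  exists rho, grid_solution (time (size x)).+1 (ncols (size x))
    (vertex_pred x) (@right_ok M) (@down_ok M) rho.
Proof.
have u0 : 0 < size (delimit x) by rewrite size_delimit addn1.
have su := size_delimit x.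
have bcols : (time (size x)).+2 + time (size x) + 1 < ncols (size x).
  by rewrite /ncols /inner; lia.
have ucols : (time (size x)).+2 + size (delimit x) + wit (size x) < ncols (size x).
  by rewrite su /ncols /inner; lia.
have run w : size w <= wit (size x) -> exists2 y,
    runs_in M (pair_word x w) (time (size x)) y & (V (pair_word x w) <-> y = [:: true]).
  move=> wk; have [y r e] := decides (pair_word x w); exists y => //.
  apply: runs_in_le r; apply: (@leq_trans (time0 (size x))) => //.
  by rewrite /time0 leq_add2r leq_expl // /pair_word size_cat su leq_add2l.
split=> [[w wk Vw]|].
  have [y [hT oT] [/(_ Vw) e _]] := run w wk; rewrite e in oT.
  exact: (tableau_complete u0 (leqnSn _) bcols ucols (ncells_eq x) wk hT oT).
move=> [rho /(tableau_sound u0 (leqnSn _) bcols ucols (ncells_eq x))[w [wk hT oT]]].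
exists w => //; have [y [_ oy] ->] := run w wk.
by rewrite -oy.
Qed.

End Correct.

End Reduction.

Lemma NP_sub_P (R : realType) (A : machine) (L : language) :
  is_PTAS R A -> in_NP L -> in_P L.
Proof.
move=> [F [a ptas]] [V [c [[M [d decides]] LV]]].
(* Only the value of [F] at eps = 1 enters, so the exponent is a constant. *)
pose e := (a * F (1^-1)%R)%N.
pose t n := cost (greduce M c d) n ^ e.
apply: (@in_P_reduction A (greduce M c d) t L).
- exact: scoped_greduce.
- exact: poly_boundedX (poly_bounded_cost _).
move=> x; rewrite sem_greduce.
have [s run hs] := ptas (reduce M c d x) 1%R (reduce_valid _ _ _ R x) isT.
exists (enc_labelling s).
  apply: runs_in_le run; apply: leq_expl.
  apply: leq_trans (size_sem x (scoped_greduce M c d)).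
  by rewrite sem_greduce size_cat leq_addl.
have i0P : 0 < (time c d (size x)).+1 * ncols c d (size x) by [].
pose i0 : 'I_(nvert (reduce M c d x)) := Ordinal i0P.
apply: iff_trans (LV x) _; apply: iff_trans (reduceP c decides x) _.
apply: iff_trans (iff_sym (grid_reduction (i0 := i0) _ _ hs)) _ => //.
by rewrite (head_enc_unary (i0 := i0) (fun i => val (s i))).
Qed.

Theorem theorem1p4 (R : realType) :
  P_neq_NP -> ~ exists A : machine, is_PTAS R A.
Proof.
move=> PNP [A ptas]; apply: PNP => L; split; first exact: P_sub_NP.
exact: NP_sub_P ptas.
Qed.
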